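(* Let $V$ be a vector space over a field $\mathbb{F}$. Then every endomorphism of $V$ is a linear combination (with coefficients in $\mathbb{F}$) of three idempotent endomorphisms of $V$.
   Context: An endomorphism $e$ is idempotent if $e^2=e$. *)

(* Defs.v *)
From HB Require Import structures.
From mathcomp Require Import all_boot all_algebra.
Set Implicit Arguments. Unset Strict Implicit. Unset Printing Implicit Defensive.
Import GRing.Theory.
Local Open Scope ring_scope.

Definition idempotent_endo (F : fieldType) (V : lmodType F)
  (e : {linear V -> V}) : Prop := forall v : V, e (e v) = e v.

(* Main.v *)
(* If p1, p2 are projections such that g = p1 g + p2 g and p_i g p_i = b_i p_i with
   b_i <> 0, then p_i g / b_i is idempotent, so g is a combination of two
   idempotents.  It thus suffices to find an idempotent e1 making the two diagonal
   blocks of f - l - a e1 scalar, where the scalar l is absorbed by replacing one of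
   the idempotents e by 1 - e.  Choose A maximal such that A and f(A) together are
   independent, let W = <A> and L = f(W): then f is a scalar l modulo W + L.  If T is
   the compression of f^2 to a map W -> L = W, the block condition on W + L reads
   T = (a + b + c) + a [U, S] for some U, S on W.

   - A infinite: A is partitioned into sequences, and every endomorphism of W is a
     commutator with the corresponding shift S.
   - x, f x, f^2 x are always dependent: T is a scalar, and U = S = 0 works.
   - Otherwise f - l has finite rank. Up to a complement on which f is scalar, V is
     a finite tower of cyclic strata of dimension at least 2. Cutting each stratum
     into pairs (w, f w), with one vector left if its dimension is odd, makes T
     triangular, and T - (a + b + c) is a commutator as soon as its trace vanishes.
     The first stratum can be taken of dimension at least 3, which leaves enough
     freedom to solve the resulting linear equation in a, b, c over any field. *)
Require Import Defs.
From HB Require Import structures.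
From mathcomp Require Import all_boot all_algebra.
From mathcomp Require Import boolp classical_sets functions cardinality ring.
Import GRing.Theory.
Local Open Scope ring_scope.

Set Implicit Arguments.
Unset Strict Implicit.
Unset Printing Implicit Defensive.

(** * Deciding identities in a module *)

Section ModuleIdentities.
Variables (F : fieldType) (V : lmodType F).

Inductive mexp : Type :=
  MVar of nat | MZero | MAdd of mexp & mexp | MOpp of mexp | MScale of F & mexp.

Fixpoint meval (env : seq V) (e : mexp) : V :=
  match e with
  | MVar n => nth 0 env n
  | MZero => 0
  | MAdd e1 e2 => meval env e1 + meval env e2
  | MOpp e1 => - meval env e1
  | MScale a e1 => a *: meval env e1
  end.

(** A separate equality test, so that the short delta list of [mod_split] computes it while the
    field operations stay folded for [ring]. *)
Fixpoint same_nat (m n : nat) : bool :=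
  match m, n with
  | 0, 0 => true
  | m'.+1, n'.+1 => same_nat m' n'
  | _, _ => false
  end.

Fixpoint mcoef (e : mexp) (i : nat) : F :=
  match e with
  | MVar n => if same_nat n i then 1 else 0
  | MZero => 0
  | MAdd e1 e2 => mcoef e1 i + mcoef e2 i
  | MOpp e1 => - mcoef e1 i
  | MScale a e1 => a * mcoef e1 i
  end.

Fixpoint msame (n : nat) (e1 e2 : mexp) : Prop :=
  match n with
  | 0 => True
  | n'.+1 => msame n' e1 e2 /\ mcoef e1 n' = mcoef e2 n'
  end.

Lemma same_natE m n : same_nat m n = (m == n).
Proof. by elim: m n => [|m IH] [|n] //=; rewrite IH. Qed.

Lemma mevalE env e :
  meval env e = \sum_(i < size env) mcoef e i *: nth 0 env i.
Proof.
elim: e => [n||e1 IH1 e2 IH2|e1 IH1|a e1 IH1] /=.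
- have [ltn|gen] := ltnP n (size env).
    rewrite (bigD1 (Ordinal ltn)) //= same_natE eqxx scale1r big1 ?addr0 // => i.
    by rewrite same_natE -val_eqE /= eq_sym => /negPf->; rewrite scale0r.
  rewrite nth_default // big1 // => i _; rewrite same_natE.
  case: eqP => [eq_ni|_]; last by rewrite scale0r.
  by rewrite eq_ni leqNgt ltn_ord in gen.
- by rewrite big1 // => i _; rewrite scale0r.
- by rewrite IH1 IH2 -big_split; apply: eq_bigr => i _; rewrite scalerDl.
- by rewrite IH1 -sumrN; apply: eq_bigr => i _; rewrite scaleNr.
- by rewrite IH1 scaler_sumr; apply: eq_bigr => i _; rewrite scalerA.
Qed.

Lemma msameP env e1 e2 : msame (size env) e1 e2 -> meval env e1 = meval env e2.
Proof.
rewrite !mevalE; elim: (size env) => [|n IH] /=; first by rewrite !big_ord0.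
by case=> /IH eqn eqc; rewrite !big_ord_recr /= eqn eqc.
Qed.

End ModuleIdentities.

(* Atoms are compared up to conversion: rewriting by linearity leaves behind
   syntactically different canonical instances. *)
Ltac mod_index x env :=
  match env with
  | ?y :: _ => let _ := constr:(erefl x : x = y) in constr:(0%N)
  | _ :: ?env' => let n := mod_index x env' in constr:(n.+1)
  end.

Ltac mod_insert x env :=
  match env with
  | _ => let _ := mod_index x env in env
  | _ => constr:(x :: env)
  end.

Ltac mod_atoms t env :=
  lazymatch t with
  | GRing.add ?t1 ?t2 => let env1 := mod_atoms t2 env in mod_atoms t1 env1
  | GRing.opp ?t1 => mod_atoms t1 env
  | GRing.scale _ ?t1 => mod_atoms t1 env
  | GRing.zero => env
  | _ => mod_insert t env
  end.

Ltac mod_reify F t env :=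
  lazymatch t with
  | GRing.add ?t1 ?t2 => let e1 := mod_reify F t1 env in
    let e2 := mod_reify F t2 env in constr:(@MAdd F e1 e2)
  | GRing.opp ?t1 => let e1 := mod_reify F t1 env in constr:(@MOpp F e1)
  | GRing.scale ?a ?t1 => let e1 := mod_reify F t1 env in constr:(@MScale F a e1)
  | GRing.zero => constr:(@MZero F)
  | _ => let n := mod_index t env in constr:(@MVar F n)
  end.

(* Reduces an identity between linear combinations of atoms to one scalar
   identity per atom. *)
Ltac mod_split :=
  match goal with
  | F : GRing.Field.type, V : GRing.Lmodule.type _ |- @eq ?T ?t1 ?t2 =>
    let env0 := mod_atoms t2 (@nil T) in
    let env := mod_atoms t1 env0 in
    let e1 := mod_reify F t1 env in
    let e2 := mod_reify F t2 env in
    refine (@msameP F V env e1 e2 _);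
    cbv beta iota zeta delta [msame mcoef same_nat size]; repeat split
  end.

Ltac mod_ring := mod_split; ring.

(** * Bases of arbitrary vector spaces *)

Section Families.
Variables (F : fieldType) (V : lmodType F) (I : Type) (v : I -> V).

(* [graph D phi] is the linear relation generated by the pairs (v i, phi i). *)
Inductive graph (E : lmodType F) (D : set I) (phi : I -> E) : V -> E -> Prop :=
| graph0 : graph D phi 0 0
| graphS a i x e :
    D i -> graph D phi x e -> graph D phi (a *: v i + x) (a *: phi i + e).

(** For [phi = v] the relation is the diagonal of the span, so spans inherit their closure
    properties from [graph]. *)
Definition lspan (D : set I) (x : V) : Prop := graph D v x x.

(** Independence as single-valuedness of every relation [graph D phi]: no finite sums or coordinates
    occur, and it is exactly what extending [phi] linearly requires. *)
Definition indep (D : set I) : Prop :=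
  forall (E : lmodType F) (phi : I -> E) e, graph D phi 0 e -> e = 0.

Lemma graph_sub (E : lmodType F) D D' (phi : I -> E) x e :
  (forall i, D i -> D' i) -> graph D phi x e -> graph D' phi x e.
Proof. by move=> sDD'; elim=> *; constructor => //; apply: sDD'. Qed.

Lemma graphP (E : lmodType F) D (phi : I -> E) a x e y d :
  graph D phi x e -> graph D phi y d -> graph D phi (a *: x + y) (a *: e + d).
Proof.
move=> gx gy; elim: gx => [|b i x' e' Di _ IH]; first by rewrite !scaler0 !add0r.
by rewrite !scalerDr !scalerA -!addrA; constructor.
Qed.

Lemma graph_mem (E : lmodType F) (D : set I) (phi : I -> E) i :
  D i -> graph D phi (v i) (phi i).
Proof.
move=> Di; rewrite -[v i]addr0 -[phi i]addr0 -[v i]scale1r -[phi i]scale1r.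
by constructor => //; constructor.
Qed.

Lemma graph_span (E : lmodType F) D (phi : I -> E) x e :
  graph D phi x e -> lspan D x.
Proof. by elim=> *; constructor. Qed.

Lemma span_ind (P : V -> Prop) D x :
  P 0 -> (forall a i y, D i -> P y -> P (a *: v i + y)) -> lspan D x -> P x.
Proof.
move=> P0 PS; suff gP y e : graph D v y e -> P y by apply: gP.
by elim=> // a i z d Di _; apply: PS.
Qed.

Lemma span_graph (E : lmodType F) D (phi : I -> E) x :
  lspan D x -> exists e, graph D phi x e.
Proof.
apply: (@span_ind (fun x => exists e, graph D phi x e)) => [|a i y Di [e' ge']].
  by exists 0; constructor.
by exists (a *: phi i + e'); constructor.
Qed.

Lemma span0 D : lspan D 0. Proof. exact: graph0. Qed.

Lemma spanP D a x y : lspan D x -> lspan D y -> lspan D (a *: x + y).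
Proof. exact: graphP. Qed.

Lemma spanZ D a x : lspan D x -> lspan D (a *: x).
Proof. by move=> sx; rewrite -[_ *: _]addr0; apply: spanP => //; apply: span0. Qed.

Lemma spanD D x y : lspan D x -> lspan D y -> lspan D (x + y).
Proof. by move=> sx sy; rewrite -[x]scale1r; apply: spanP. Qed.

Lemma spanN D x : lspan D x -> lspan D (- x).
Proof. by rewrite -scaleN1r; apply: spanZ. Qed.

Lemma spanB D x y : lspan D x -> lspan D y -> lspan D (x - y).
Proof. by move=> sx sy; apply/spanD/spanN. Qed.

Lemma span_mem (D : set I) i : D i -> lspan D (v i).
Proof. exact: graph_mem. Qed.

Lemma span_elim (P : V -> Prop) (D : set I) x :
  P 0 -> (forall a y z, P y -> P z -> P (a *: y + z)) ->
  (forall i, D i -> P (v i)) -> lspan D x -> P x.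
Proof. by move=> P0 PP Pv; apply: (@span_ind P) => // a i y Di; apply: PP; apply: Pv. Qed.

Lemma indep_sub (D D' : set I) : (forall i, D i -> D' i) -> indep D' -> indep D.
Proof. by move=> sDD' ind E phi e /(graph_sub sDD')/ind. Qed.

Lemma indep_set0 : indep set0.
Proof.
have graph_set0 (E : lmodType F) phi x e : graph set0 phi x e -> e = 0.
  by elim.
by move=> E phi e; apply: graph_set0.
Qed.

Lemma graph_add (E : lmodType F) D (phi : I -> E) i x e :
  graph (D `|` [set i])%classic phi x e ->
  exists a y d, [/\ graph D phi y d, x = a *: v i + y & e = a *: phi i + d].
Proof.
elim=> [|a j y d Dj _ [b [z [c [gz -> ->]]]]].
  by exists 0, 0, 0; split; [constructor|rewrite scale0r addr0|rewrite scale0r addr0].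
case: Dj => [Dj|->].
  by exists b, (a *: v j + z), (a *: phi j + c); split; [constructor|mod_ring|mod_ring].
by exists (a + b), z, c; split; [|mod_ring|mod_ring].
Qed.

Lemma indep_add D i : indep D -> ~ lspan D (v i) -> indep (D `|` [set i])%classic.
Proof.
move=> indD nspan E phi e /graph_add[a [y [d [gy eq0 ->]]]].
have [a0|a_neq0] := eqVneq a 0.
  move: eq0 gy; rewrite a0 scale0r add0r => <- /indD ->.
  by rewrite scale0r addr0.
case: nspan; have -> : v i = (- a^-1) *: y + 0.
  rewrite addr0 scaleNr -scalerN; have -> : - y = a *: v i.
    by apply/eqP; rewrite eq_sym -addr_eq0 -eq0.
  by rewrite scalerA mulVf // scale1r.
by apply: spanP; [apply: graph_span gy|apply: span0].
Qed.

(** A derivation uses finitely many indices, so along a chain it lives in a single member. The first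
    alternative is for derivations that use no index, as the chain may be empty. *)
Lemma graph_bigcup (E : lmodType F) (C : set (set I)) (phi : I -> E) x e :
  total_on C subset -> graph (\bigcup_(D in C) D)%classic phi x e ->
  graph set0 phi x e \/ exists2 D, C D & graph D phi x e.
Proof.
move=> totC; elim=> [|a i y d [D CD Di] _ IH]; first by left; constructor.
right; case: IH => [g0|[D' CD' g]].
  by exists D => //; constructor => //; apply: graph_sub g0.
have [sDD'|sD'D] := totC _ _ CD CD'.
  by exists D' => //; constructor => //; apply: sDD'.
by exists D => //; constructor => //; apply: graph_sub g.
Qed.

Lemma indep_bigcup (C : set (set I)) :
  total_on C subset -> (forall D, C D -> indep D) ->
  indep (\bigcup_(D in C) D)%classic.
Proof.
move=> totC indC E phi e /(graph_bigcup totC)[/indep_set0//|[D CD]].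
exact: indC CD E phi e.
Qed.

Lemma linear_pack (E : lmodType F) (g : V -> E) :
  (forall a x y, g (a *: x + y) = a *: g x + g y) ->
  exists h : {linear V -> E}, h =1 g.
Proof.
move=> lin_g; pose m := GRing.isLinear.Build F V E *:%R g lin_g.
by exists (HB.pack_for {linear V -> E} g m).
Qed.

(** Spanning makes the relation [graph D phi] total and independence makes it single-valued, so
    choice turns it into a linear map. *)
Lemma linear_ext (E : lmodType F) D (phi : I -> E) :
  indep D -> (forall x, lspan D x) ->
  exists h : {linear V -> E}, forall i, D i -> h (v i) = phi i.
Proof.
move=> indD spanT; have /choice[g gP] : forall x, exists e, graph D phi x e.
  by move=> x; apply: span_graph.
have g_uniq x e : graph D phi x e -> g x = e.
  move=> gx; have := graphP (- 1) gx (gP x).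
  by rewrite !scaleN1r !addNr => /indD/eqP; rewrite addrC subr_eq0 => /eqP.
have [h hE] : exists h : {linear V -> E}, h =1 g.
  by apply: linear_pack => a x y; apply/g_uniq/graphP.
by exists h => i Di; rewrite hE; apply/g_uniq/graph_mem.
Qed.

Lemma linear_eq_span (E : lmodType F) D (g h : {linear V -> E}) x :
  (forall i, D i -> g (v i) = h (v i)) -> lspan D x -> g x = h x.
Proof.
move=> eq_gh; apply: (@span_elim (fun x => g x = h x)) => // [|a y z eqy eqz]; first by rewrite !raddf0.
by rewrite !linearP eqy eqz.
Qed.

End Families.
Arguments lspan {F V I} v D x.
Arguments indep {F V I} v D.
Arguments graph {F V I} v {E} D phi _ _.

(** * Completion of an independent family to a basis *)

Section Completion.
Variables (F : fieldType) (V : lmodType F) (I : Type) (v : I -> V).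

(** Added vectors are their own indices, so that a completion is a set [K : set V], to which Zorn's
    lemma applies. *)
Definition with_vectors (i : I + V) : V := match i with inl i => v i | inr x => x end.

Definition sum_set (D : set I) (K : set V) : set (I + V) :=
  fun i => match i with inl i => D i | inr x => K x end.

Lemma indep_inl D : indep v D -> indep with_vectors (sum_set D set0).
Proof.
move=> indD E phi e g0; apply: (indD E (fun i => phi (inl i))).
suff gP x d : graph with_vectors (sum_set D set0) phi x d ->
  graph v D (fun i => phi (inl i)) x d by apply: gP.
by elim=> [|a [i|y] z c //= Di _ g]; constructor.
Qed.

(** Zorn's lemma for the sets whose union with [K0] stays independent; forming the union, rather
    than demanding that [K0] be contained, keeps the empty chain harmless. A vector outside the span
    could be added to a maximal set. *)
Lemma basis_completion D K0 : indep with_vectors (sum_set D K0) ->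
  exists K : set V, [/\ forall x, K0 x -> K x, indep with_vectors (sum_set D K) &
    forall x, lspan with_vectors (sum_set D K) x].
Proof.
move=> indK0; pose P := [set K | indep with_vectors (sum_set D (K0 `|` K))]%classic.
have [C sCP totC|K [PK maxK]] := @Zorn_bigcup V P.
  have [->|/set0P[K1 CK1]] := eqVneq C set0%classic.
    by rewrite /P /= bigcup_set0 setU0.
  pose C' := [set sum_set D (K0 `|` K) | K in C]%classic.
  have indC' : indep with_vectors (\bigcup_(X in C') X)%classic.
    apply: indep_bigcup => [_ _ [K CK <-] [L CL <-]|_ [K CK <-]]; last exact: sCP.
    have [sKL|sLK] := totC _ _ CK CL; [left|right] => -[i|x] //= [K0x|Kx];
      by [left|right; auto].
  apply: indep_sub indC' => -[i Di|x [K0x|[K CK Kx]]].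
  - by exists (sum_set D (K0 `|` K1)) => //; exists K1.
  - by exists (sum_set D (K0 `|` K1)); [exists K1|left].
  by exists (sum_set D (K0 `|` K)); [exists K|right].
exists (K0 `|` K)%classic; split=> [x K0x||x]; [by left|exact: PK|].
apply: contrapT => nx.
have nKx : ~ K x.
  by move=> Kx; apply/nx/(@span_mem _ _ _ with_vectors _ (inr x)); right.
apply: (maxK (K `|` [set x])%classic).
  by split; [left|move/(_ x)/(_ (or_intror erefl))].
rewrite /P /=; apply: indep_sub (indep_add (i := inr x) PK nx).
by move=> [i Di|y [K0y|[Ky|->]]]; [left|left; left|left; right|right].
Qed.

Lemma linear_ext_indep (E : lmodType F) D (phi : I -> E) : indep v D ->
  exists h : {linear V -> E}, forall i, D i -> h (v i) = phi i.
Proof.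
move=> /indep_inl indD; have [K [_ ind spanT]] := basis_completion indD.
have [h hE] := linear_ext (fun i => match i with inl i => phi i | inr _ => 0 end) ind spanT.
by exists h => i Di; apply: (hE (inl i)).
Qed.

End Completion.

(** * Block conditions for linear combinations of idempotents *)

Section Assembly.
Variables (F : fieldType) (V : lmodType F).
Implicit Types f g e : {linear V -> V}.

Definition combination (f : V -> V) (a b c : F) : Prop :=
  exists e1 e2 e3 : {linear V -> V},
    [/\ idempotent_endo e1, idempotent_endo e2, idempotent_endo e3 &
        forall v, f v = a *: e1 v + b *: e2 v + c *: e3 v].

(** With g = f - a e1, the relation p g p = d p gives (p g)^2 = d p g, so p g / d is idempotent, and
    g is the sum of p1 g and p2 g. *)
Lemma combination_two_blocks (f e1 p1 p2 : {linear V -> V}) (a b c : F) :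
  b != 0 -> c != 0 -> idempotent_endo e1 ->
  (forall v, f v - a *: e1 v = p1 (f v - a *: e1 v) + p2 (f v - a *: e1 v)) ->
  (forall v, p1 (f (p1 v) - a *: e1 (p1 v)) = b *: p1 v) ->
  (forall v, p2 (f (p2 v) - a *: e1 (p2 v)) = c *: p2 v) ->
  combination f a b c.
Proof.
move=> b_neq0 c_neq0 idem_e1 split_g block1 block2.
have [g gE] : exists g : {linear V -> V}, g =1 fun v => f v - a *: e1 v.
  by apply: linear_pack => k x y; rewrite !linearP /=; mod_ring.
have block_idem (p : {linear V -> V}) d : d != 0 ->
    (forall v, p (g (p v)) = d *: p v) ->
    exists2 e : {linear V -> V}, idempotent_endo e & forall v, d *: e v = p (g v).
  move=> d_neq0 block.
  have [e eE] : exists e : {linear V -> V}, e =1 fun v => d^-1 *: p (g v).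
    by apply: linear_pack => k x y; rewrite !linearP /=; mod_ring.
  exists e => v; last by rewrite eE scalerA mulfV // scale1r.
  by rewrite !eE !linearZ /= block (scalerA _ d) mulVf // scale1r.
have [|e2 idem_e2 e2E] := block_idem p1 b b_neq0; first by move=> v; rewrite gE.
have [|e3 idem_e3 e3E] := block_idem p2 c c_neq0; first by move=> v; rewrite gE.
exists e1, e2, e3; split=> // v; rewrite e2E e3E -addrA !gE -split_g.
by rewrite addrC subrK.
Qed.

Definition decomposable (f : V -> V) : Prop := exists a b c, combination f a b c.

(* The scalar part l is absorbed by replacing an idempotent e with 1 - e. *)
Lemma combination_shift f g (a b c l : F) :
  (forall v, g v = f v - l *: v) -> combination g a b c ->
  l = 0 \/ - l \in [:: a; b; c] -> decomposable f.
Proof.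
move=> gE [e1 [e2 [e3 [i1 i2 i3 fE]]]].
have compl e : idempotent_endo e -> exists2 e' : {linear V -> V},
    idempotent_endo e' & forall v, e' v = v - e v.
  move=> idem_e; have [e' e'E] : exists e' : {linear V -> V}, e' =1 fun v => v - e v.
    by apply: linear_pack => k x y; rewrite !linearP /=; mod_ring.
  by exists e' => // v; rewrite !e'E linearB idem_e subrr subr0.
have fE' v : f v = l *: v + (a *: e1 v + b *: e2 v + c *: e3 v).
  by rewrite -fE gE addrC subrK.
case=> [l0|].
  exists a, b, c, e1, e2, e3; split=> // v.
  by rewrite fE' l0 scale0r add0r.
rewrite !inE => /or3P[] /eqP lE.
- have [e1' i1' e1E] := compl _ i1; exists l, b, c, e1', e2, e3; split=> // v.
  by rewrite fE' e1E -lE; mod_ring.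
- have [e2' i2' e2E] := compl _ i2; exists a, l, c, e1, e2', e3; split=> // v.
  by rewrite fE' e2E -lE; mod_ring.
have [e3' i3' e3E] := compl _ i3; exists a, b, l, e1, e2, e3'; split=> // v.
by rewrite fE' e3E -lE; mod_ring.
Qed.

Section Glue.
Variables (f piW q S U rho1 rho2 theta h A j p : {linear V -> V}) (a b c : F).
Hypotheses (b_neq0 : b != 0) (c_neq0 : c != 0).
(** Here W is the image of [piW], [q] inverts f from L = f(W) to W, j(W) is a second complement of W
    in W + L, and [p] projects W + L onto W along j(W). The images R1, R2 of [rho1], [rho2] are
    added to the blocks W and j(W); [rest_f] and [rest_h] say that the values of f and h lie in the
    sum of the four parts. *)
Hypotheses (AE : forall v, A v = a *: U (S v) + b *: v)
  (jE : forall v, j v = f v - A v) (pE : forall v, p v = piW v + A (q v)).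
Hypotheses (piWK : forall v, piW (piW v) = piW v)
  (q_piW : forall v, q (piW v) = 0) (piW_q : forall v, piW (q v) = q v)
  (piW_S : forall v, piW (S v) = S v) (piW_U : forall v, piW (U v) = U v)
  (piW_f : forall v, piW (f (piW v)) = 0)
  (q_f : forall v, q (f (piW v)) = piW v)
  (q_ff : forall v, q (f (f (piW v))) =
     (a + b + c) *: piW v + a *: (U (S (piW v)) - S (U (piW v)))).
Hypotheses (rho1_piW : forall v, rho1 (piW v) = 0)
  (rho2_piW : forall v, rho2 (piW v) = 0)
  (rho1_f : forall v, rho1 (f (piW v)) = 0)
  (rho2_f : forall v, rho2 (f (piW v)) = 0)
  (piW_rho1 : forall v, piW (rho1 v) = 0) (piW_rho2 : forall v, piW (rho2 v) = 0)
  (q_rho1 : forall v, q (rho1 v) = 0) (q_rho2 : forall v, q (rho2 v) = 0)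
  (rho1K : forall v, rho1 (rho1 v) = rho1 v)
  (rho2K : forall v, rho2 (rho2 v) = rho2 v)
  (rho12 : forall v, rho1 (rho2 v) = 0) (rho21 : forall v, rho2 (rho1 v) = 0).
Hypothesis (rho2_theta : forall v, rho2 (theta v) = theta v).
Hypotheses (hK : forall v, h (h v) = h v)
  (y_h : forall v, S (p (h v)) + q (h v) = 0)
  (h_G : forall v, h (U (piW v) + j (piW v - S (U (piW v))) + theta (piW v)) = 0)
  (h_W : forall v, p (h (piW v)) + rho1 (h (piW v)) = 0)
  (block_rho1 : forall v, let g := f (rho1 v) - a *: h (rho1 v) in
     p g + rho1 g = b *: rho1 v)
  (block_j : forall v, let x := h (j (piW v)) in
     rho2 (f (j (piW v))) = a *: (theta (piW v) + (j (q x) + rho2 x)))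
  (block_rho2 : forall v, let g := f (rho2 v) - a *: h (rho2 v) in
     j (q g) + rho2 g = c *: rho2 v)
  (rest_f : forall v, f v = piW (f v) + f (q (f v)) + rho1 (f v) + rho2 (f v))
  (rest_h : forall v, h v = piW (h v) + f (q (h v)) + rho1 (h v) + rho2 (h v)).

(* On [W + L] the idempotent has block form [[U; 1 - SU] [S, 1]], whose diagonal
   blocks US and 1 - SU add up to 1 + [U, S]. *)
Lemma combination_glue : combination f a b c.
Proof using All.
have piW_A v : piW (A (piW v)) = A (piW v).
  by rewrite AE linearD !linearZ /= piW_U piWK.
have W_A v : piW v = v -> piW (A v) = A v by move<-.
have q_W v : piW v = v -> q v = 0 by move<-.
have r1W v : piW v = v -> rho1 v = 0 by move<-.
have r2W v : piW v = v -> rho2 v = 0 by move<-.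
have piWj v : piW v = v -> piW (j v) = - A v.
  by move=> vW; rewrite jE linearB /= W_A // -vW piW_f sub0r.
have qj v : piW v = v -> q (j v) = v.
  by move=> vW; rewrite jE linearB /= (q_W (A v)) ?W_A // subr0 -vW q_f vW.
have pj v : piW v = v -> p (j v) = 0.
  by move=> vW; rewrite pE piWj // qj // addNr.
have r1j v : piW v = v -> rho1 (j v) = 0.
  by move=> vW; rewrite jE linearB /= (r1W (A v)) ?W_A // -vW rho1_f subr0.
have r2j v : piW v = v -> rho2 (j v) = 0.
  by move=> vW; rewrite jE linearB /= (r2W (A v)) ?W_A // -vW rho2_f subr0.
have p_W v : piW v = v -> p v = v.
  by move=> vW; rewrite pE (q_W v) // linear0 addr0.
have piW_p v : piW (p v) = p v by rewrite pE linearD /= piWK W_A.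
have p_th v : p (theta v) = 0.
  by rewrite -rho2_theta pE piW_rho2 q_rho2 linear0 addr0.
have q_th v : q (theta v) = 0 by rewrite -rho2_theta.
have r1_th v : rho1 (theta v) = 0 by rewrite -rho2_theta.
have [y yE] : exists y : {linear V -> V}, y =1 fun v => S (p v) + q v.
  by apply: linear_pack => k x z; rewrite !linearP /=; mod_ring.
have [G GE] : exists G : {linear V -> V},
    G =1 fun v => U v + j (v - S (U v)) + theta v.
  by apply: linear_pack => k x z; rewrite !(linearP, linearB) /=; mod_ring.
have piW_y v : piW (y v) = y v by rewrite yE linearD /= piW_S piW_q.
have W1SU v : piW v = v -> piW (v - S (U v)) = v - S (U v).
  by move=> vW; rewrite linearB /= piW_S vW.
have yG v : piW v = v -> y (G v) = v.
  move=> vW; rewrite GE yE !(linearD p) !(linearD q) /= p_th q_th !addr0.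
  by rewrite pj ?W1SU // qj ?W1SU // p_W // (q_W (U v)) // add0r addr0 addrC subrK.
(* Since y G = 1 on W, G y is idempotent; h is an idempotent orthogonal to it, because y h = 0 and h
   G = 0 on W. *)
have [e1 e1E] : exists e1 : {linear V -> V}, e1 =1 fun v => G (y v) + h v.
  by apply: linear_pack => k x z; rewrite !linearP /=; mod_ring.
have yh v : y (h v) = 0 by rewrite yE y_h.
have hG v : piW v = v -> h (G v) = 0 by move<-; rewrite GE h_G.
have idem_e1 : idempotent_endo e1.
  move=> v; rewrite !e1E !linearD /= hK hG // yh yG // linear0 addr0.
  by rewrite add0r.
(* [p1] and [p2] are the projections onto the two blocks W + R1 and j(W) + R2. *)
have [p1 p1E] : exists p1 : {linear V -> V}, p1 =1 fun v => p v + rho1 v.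
  by apply: linear_pack => k x z; rewrite !linearP /=; mod_ring.
have [p2 p2E] : exists p2 : {linear V -> V}, p2 =1 fun v => j (q v) + rho2 v.
  by apply: linear_pack => k x z; rewrite !linearP /=; mod_ring.
have p1G v : piW v = v -> p1 (G v) = U v.
  move=> vW; rewrite GE p1E !(linearD p) !(linearD rho1) /= p_th r1_th.
  by rewrite pj ?W1SU // r1j ?W1SU // p_W // (r1W (U v)) // !addr0.
have p2G v : piW v = v -> p2 (G v) = j (v - S (U v)) + theta v.
  move=> vW; rewrite GE p2E !(linearD q) !(linearD rho2) /= q_th rho2_theta.
  rewrite qj ?W1SU // r2j ?W1SU // (q_W (U v)) // (r2W (U v)) //.
  by rewrite !add0r addr0.
have y_rho1 v : y (rho1 v) = 0.
  by rewrite yE pE piW_rho1 q_rho1 !linear0 !addr0 linear0.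
have y_rho2 v : y (rho2 v) = 0.
  by rewrite yE pE piW_rho2 q_rho2 !linear0 !addr0 linear0.
have p12 x : p1 x + p2 x = piW x + f (q x) + rho1 x + rho2 x.
  by rewrite p1E p2E pE jE; mod_ring.
apply: (@combination_two_blocks f e1 p1 p2) => // v.
- have p12_e1 : p1 (e1 v) + p2 (e1 v) = e1 v.
    rewrite !e1E !linearD /= p1G // p2G //.
    have := p12 (h v); rewrite -rest_h => p12h.
    by rewrite -[in RHS]p12h GE; mod_ring.
  have := p12 (f v); rewrite -rest_f => p12f.
  rewrite !linearB !linearZ /= -[in LHS]p12f -[in LHS]p12_e1.
  mod_ring.
- rewrite (p1E v); move: (p v) (piW_p v) => w wW.
  have e1w : p1 (e1 w) = U (S w).
    rewrite e1E linearD /= yE p_W // q_W // addr0 p1G // p1E.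
    by rewrite -{2 3}wW h_W addr0.
  have e1r : e1 (rho1 v) = h (rho1 v) by rewrite e1E y_rho1 linear0 add0r.
  have p1f : p1 (f w) = A w.
    have -> : f w = j w + A w by rewrite jE subrK.
    rewrite p1E !(linearD p) !(linearD rho1) /= pj // r1j // p_W ?W_A // (r1W (A w)) ?W_A //.
    by rewrite !add0r addr0.
  have := block_rho1 v; rewrite /= -p1E linearB linearZ /= => br.
  rewrite linearB linearZ /= !(linearD f) !(linearD e1) !(linearD p1) /= e1r p1f e1w AE.
  rewrite (scalerDr b) -br; mod_ring.
rewrite (p2E v); move: (q v) (piW_q v) => w wW.
have e1r : e1 (rho2 v) = h (rho2 v) by rewrite e1E y_rho2 linear0 add0r.
have e1j : e1 (j w) = G w + h (j w) by rewrite e1E yE pj // qj // linear0 add0r.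
(* The equation for f^2 enters here: T - A = c + a (1 - S U), and 1 - S U is the second diagonal
   block of [e1] on W + L. *)
have qfj : q (f (j w)) = c *: w + a *: (w - S (U w)).
  have := q_ff w; rewrite wW jE !linearB /= => ->.
  have -> : q (f (A w)) = A w by rewrite -(W_A w wW) q_f.
  by rewrite AE; mod_ring.
have := block_rho2 v; rewrite /= -p2E => br.
have := block_j w; rewrite /= wW -p2E => bj.
rewrite linearB linearZ /= !(linearD f) !(linearD e1) !(linearD p2) /= e1r e1j.
move: br; rewrite linearB linearZ /= (scalerDr c) => <-.
rewrite (linearD p2) /= p2G // (p2E (f (j w))) qfj bj !linearD !linearZ /=.
by mod_ring.
Qed.
End Glue.
End Assembly.

(** * Maximal families of pairs x, f x *)

Section Pairs.
Variables (F : fieldType) (V : lmodType F).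
Implicit Types f g : {linear V -> V}.

Lemma linear_span0 (I : Type) (v : I -> V) (D : set I) (E : lmodType F)
    (g : {linear V -> E}) x :
  (forall i, D i -> g (v i) = 0) -> lspan v D x -> g x = 0.
Proof.
move=> g0; apply: (@span_elim _ _ _ v (fun x => g x = 0)) => [|a y z y0 z0|//]; first exact: linear0.
by rewrite linearP y0 z0 scaler0 addr0.
Qed.

Definition pair_vec f (i : V * bool) : V := if i.2 then f i.1 else i.1.
Definition pair_set (A : set V) : set (V * bool) := [set i | A i.1]%classic.

(** If both x and f x enlarged the span independently, x could be added to a maximal [A]; hence f x
    lies in the span up to a multiple of x. *)
Lemma maximal_pairs f : exists A : set V, indep (pair_vec f) (pair_set A) /\
  forall x, ~ lspan (pair_vec f) (pair_set A) x ->
    exists m, lspan (pair_vec f) (pair_set A) (f x - m *: x).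
Proof.
pose P := [set A : set V | indep (pair_vec f) (pair_set A)]%classic.
have [C sCP totC|A [PA maxA]] := @Zorn_bigcup V P.
  have ind : indep (pair_vec f) (\bigcup_(X in [set pair_set A | A in C]) X)%classic.
    apply: indep_bigcup => [_ _ [X CX <-] [Y CY <-]|_ [X CX <-]]; last exact: sCP.
    by have [sXY|sYX] := totC _ _ CX CY; [left=> i; apply: sXY|right=> i; apply: sYX].
  by apply: indep_sub ind => i [X CX Xi]; exists (pair_set X) => //; exists X.
exists A; split=> // x nx; apply: contrapT => nspan.
have nAx : ~ A x by move=> Ax; apply/nx/(@span_mem _ _ _ (pair_vec f) _ (x, false)).
apply: (maxA (A `|` [set x])%classic).
  by split; [left|move/(_ x)/(_ (or_intror erefl))].
have ind1 : indep (pair_vec f) (pair_set A `|` [set (x, false)])%classic.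
  exact: indep_add.
have ind2 := indep_add (i := (x, true)) ind1.
rewrite /P /=; apply: indep_sub (ind2 _) => [[y b]|].
  case=> [Ay|/= ->]; first by left; left.
  by case: b; [right|left; right].
move=> sp; have [a [y [d [/graph_span sy fxE _]]]] := graph_add sp; case: nspan; exists a.
by rewrite -[f x]/(pair_vec f (x, true)) fxE addrC addKr.
Qed.

(** Every vector outside the span is an eigenvector modulo the span, and comparing k0, k and k0 + k
    shows that any two vectors of [K] have the same eigenvalue. *)
Lemma scalar_mod_complement (I : Type) (v : I -> V) (D : set I) (K : set V) f :
  indep (with_vectors v) (sum_set D K) ->
  (forall x, lspan (with_vectors v) (sum_set D K) x) ->
  (forall x, ~ lspan v D x -> exists m, lspan v D (f x - m *: x)) ->
  exists l, forall k, K k -> lspan v D (f k - l *: k).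
Proof.
move=> ind spanT eig.
have coord k : exists g : {linear V -> F^o},
    (forall x, lspan v D x -> g x = 0) /\ (forall k', K k' -> g k' = (k == k')%:R).
  have [g gE] := linear_ext (E := F^o)
    (fun i => match i with inl _ => 0 | inr k' => (k == k')%:R : F^o end) ind spanT.
  exists g; split=> [x|k' Kk']; last by rewrite (gE (inr k')).
  by apply: linear_span0 => i Di; rewrite (gE (inl i)).
have nspan k : K k -> ~ lspan v D k.
  move=> Kk; have [g [g0 gK]] := coord k => /g0.
  by rewrite gK // eqxx => /eqP; rewrite oner_eq0.
have [->|/set0P[k0 Kk0]] := eqVneq K set0; first by exists 0.
have [m0 sm0] := eig _ (nspan _ Kk0).
exists m0 => k Kk; have [<-//|neqk] := eqVneq k0 k.
have [m sm] := eig _ (nspan _ Kk).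
have [g [g0 gK]] := coord k; have [g' [g'0 g'K]] := coord k0.
have [n sn] : exists n, lspan v D (f (k0 + k) - n *: (k0 + k)).
  apply: eig => /g0; rewrite linearD !gK // eqxx eq_sym (negPf neqk) add0r => /eqP.
  by rewrite oner_eq0.
(* The coordinates of this vector at k0 and k vanish, whence n = m0 and n = m. *)
have key : lspan v D ((n - m0) *: k0 + (n - m) *: k).
  have -> : (n - m0) *: k0 + (n - m) *: k =
      (f k0 - m0 *: k0) + (f k - m *: k) - (f (k0 + k) - n *: (k0 + k)).
    by rewrite (linearD f); mod_ring.
  by apply: spanB => //; apply: spanD.
have /eqP := g0 _ key; have /eqP := g'0 _ key.
rewrite !linearD !linearZ /= !gK // !g'K // !eqxx (eq_sym k) (negPf neqk).
rewrite !scaler0 addr0 add0r -![_ *: 1]/(_ * 1) !mulr1 !subr_eq0 => /eqP <- /eqP nm.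
by rewrite scalerN nm.
Qed.

End Pairs.

(** * Bases made of pairs, and the projections they define *)

Section PairBasis.
Variables (F : fieldType) (V : lmodType F).
Implicit Types f g : {linear V -> V}.

(* The vectors x and f x, for x in A, together with the vectors of K form a
   basis of V, expressed by its universal property. *)
Record pair_basis (f : V -> V) (A K : set V) : Prop := PairBasis {
  pair_ext : forall (E : lmodType F) (s u t : V -> E), exists g : {linear V -> E},
    [/\ forall x, A x -> g x = s x, forall x, A x -> g (f x) = u x &
        forall k, K k -> g k = t k];
  pair_eq : forall (E : lmodType F) (g h : {linear V -> E}),
    (forall x, A x -> g x = h x) -> (forall x, A x -> g (f x) = h (f x)) ->
    (forall k, K k -> g k = h k) -> g =1 h }.

(** Passing from f x to f x - l x is a unitriangular change of basis. *)
Lemma pair_basis_shift f (f1 : {linear V -> V}) A K l :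
  indep (with_vectors (pair_vec f)) (sum_set (pair_set A) K) ->
  (forall x, lspan (with_vectors (pair_vec f)) (sum_set (pair_set A) K) x) ->
  (forall v, f1 v = f v - l *: v) ->
  pair_basis f1 A K.
Proof.
move=> ind spanT f1E; split=> [E s u t|E g h eqA eqfA eqK v].
  have [g gE] := linear_ext (fun i => match i with
    | inl (x, true) => u x + l *: s x | inl (x, false) => s x | inr k => t k end)
    ind spanT.
  have gA x : A x -> g x = s x by move=> Ax; rewrite (gE (inl (x, false))).
  exists g; split=> // [x Ax|k Kk]; last by rewrite (gE (inr k)).
  have gfx : g (f x) = u x + l *: s x := gE (inl (x, true)) Ax.
  rewrite f1E linearB linearZ /= (gA x) //.
  rewrite gfx; mod_ring.
apply: linear_eq_span (spanT v) => -[[x []] Ax|k Kk]; rewrite /= /pair_vec /=; last exact: eqK.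
  have -> : f x = f1 x + l *: x by rewrite f1E subrK.
  by rewrite !linearD !linearZ /= eqfA // eqA.
exact: eqA.
Qed.

(** [piW], f q and [rho] are the projections of a decomposition V = W + f(W) + R, and [q] carries
    f(W) back to W. *)
Record pair_frame (f piW q rho : V -> V) : Prop := PairFrame {
  piW_piW : forall v, piW (piW v) = piW v;
  q_piW : forall v, q (piW v) = 0;
  piW_q : forall v, piW (q v) = q v;
  piW_f : forall v, piW (f (piW v)) = 0;
  q_f : forall v, q (f (piW v)) = piW v;
  rho_piW : forall v, rho (piW v) = 0;
  rho_f : forall v, rho (f (piW v)) = 0;
  piW_rho : forall v, piW (rho v) = 0;
  q_rho : forall v, q (rho v) = 0;
  rho_rho : forall v, rho (rho v) = rho v;
  frame_sum : forall v, v = piW v + f (q v) + rho v }.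

Lemma pair_basis_frame f A K : pair_basis f A K ->
  exists piW q rho : {linear V -> V}, [/\ pair_frame f piW q rho,
    forall x, A x -> piW x = x, forall k, K k -> rho k = k &
    forall (E : lmodType F) (g h : {linear V -> E}),
      (forall x, A x -> g x = h x) -> forall v, g (piW v) = h (piW v)].
Proof.
move=> pb.
have [piW [piWA piWf piWK]] := pair_ext pb id (fun=> 0) (fun=> 0).
have [q [qA qf qK]] := pair_ext pb (fun=> 0) id (fun=> 0).
have [rho [rhoA rhof rhoK]] := pair_ext pb (fun=> 0) (fun=> 0) id.
have restrict (E : lmodType F) (g h : {linear V -> E}) :
    (forall x, A x -> g x = h x) -> forall v, g (piW v) = h (piW v).
  move=> eqA; apply: (pair_eq pb (g := g \o piW) (h := h \o piW)) => x Ax /=.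
  - by rewrite piWA // eqA.
  - by rewrite piWf // !linear0.
  by rewrite piWK // !linear0.
have vanish (g : {linear V -> V}) : (forall x, A x -> g x = 0) ->
    forall v, g (piW v) = 0.
  exact: (restrict _ g \0).
exists piW, q, rho; split=> //; split.
- by apply: (restrict _ piW idfun).
- exact: (vanish q).
- by apply: (pair_eq pb (g := piW \o q) (h := q)) => x Ax /=;
    [rewrite qA // linear0|rewrite qf // piWA|rewrite qK // linear0].
- by apply: (vanish (piW \o f)).
- by apply: (restrict _ (q \o f) idfun).
- exact: (vanish rho).
- by apply: (vanish (rho \o f)).
- by apply: (pair_eq pb (g := piW \o rho) (h := \0)) => x Ax /=;
    [rewrite rhoA // linear0|rewrite rhof // linear0|rewrite rhoK // piWK].
- by apply: (pair_eq pb (g := q \o rho) (h := \0)) => x Ax /=;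
    [rewrite rhoA // linear0|rewrite rhof // linear0|rewrite rhoK // qK].
- by apply: (pair_eq pb (g := rho \o rho) (h := rho)) => x Ax /=;
    [rewrite (rhoA x) // linear0|rewrite (rhof x) // linear0|rewrite (rhoK x) // rhoK].
have [g gE] : exists g : {linear V -> V}, g =1 fun v => piW v + f (q v) + rho v.
  by apply: linear_pack => k x y; rewrite !linearP /=; mod_ring.
move=> v; rewrite -gE; apply: (pair_eq pb (g := idfun) (h := g)) => x Ax /=; rewrite gE.
- by rewrite (piWA x) ?qA ?rhoA ?linear0 ?addr0.
- by rewrite piWf ?qf ?rhof ?add0r ?addr0.
by rewrite piWK ?qK ?rhoK ?linear0 ?add0r.
Qed.

(** All of R joins the first block. Since rho f rho = 0 and h acts as the identity modulo W + L on
    R, the diagonal entry of f - a h there is -a; this is why b = - a. *)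
Lemma combination_pairs f (piW q rho S U : {linear V -> V}) (a c : F) :
  a != 0 -> c != 0 -> pair_frame f piW q rho ->
  (forall v, rho (f (rho v)) = 0) ->
  (forall v, piW (S v) = S v) -> (forall v, piW (U v) = U v) ->
  (forall v, q (f (f (piW v))) =
     c *: piW v + a *: (U (S (piW v)) - S (U (piW v)))) ->
  combination f a (- a) c.
Proof.
move=> a_neq0 c_neq0 fr rho_f_rho piW_S piW_U q_ff.
have [B BE] : exists B : {linear V -> V}, forall v, B v = a *: U (S v) + (- a) *: v.
  by apply: linear_pack => k x y; rewrite !linearP /=; mod_ring.
have [j jE] : exists j : {linear V -> V}, forall v, j v = f v - B v.
  by apply: linear_pack => k x y; rewrite !linearP /=; mod_ring.
have [p pE] : exists p : {linear V -> V}, forall v, p v = piW v + B (q v).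
  by apply: linear_pack => k x y; rewrite !linearP /=; mod_ring.
have [r rE] : exists r : {linear V -> V}, forall v, r v = a^-1 *: p (f (rho v)).
  by apply: linear_pack => k x y; rewrite !linearP /=; mod_ring.
(* The summand [r] cancels the entry p f rho of the first block, and - j S r restores S p h + q h =
   0. *)
have [h hE] : exists h : {linear V -> V}, forall v, h v = rho v + r v - j (S (r v)).
  by apply: linear_pack => k x y; rewrite !linearP /=; mod_ring.
have piW_B v : piW (B (piW v)) = B (piW v).
  by rewrite BE linearD !linearZ /= piW_U (piW_piW fr).
have piW_p v : piW (p v) = p v.
  by rewrite pE linearD /= (piW_piW fr) -(piW_q fr) piW_B.
have piW_r v : piW (r v) = r v by rewrite rE linearZ /= piW_p.
have [W_q W_rho] : (forall v, piW v = v -> q v = 0) /\ (forall v, piW v = v -> rho v = 0).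
  by split=> v <-; rewrite ?(q_piW fr) ?(rho_piW fr).
have W_B v : piW v = v -> piW (B v) = B v by move<-.
have W_p v : piW v = v -> p v = v by move=> vW; rewrite pE W_q // linear0 addr0.
have W_f v : piW v = v -> [/\ piW (f v) = 0, q (f v) = v & rho (f v) = 0].
  by move=> <-; rewrite (piW_f fr) (q_f fr) (rho_f fr).
have W_j v : piW v = v -> [/\ piW (j v) = - B v, q (j v) = v, rho (j v) = 0 & p (j v) = 0].
  move=> vW; have [f1 f2 f3] := W_f v vW.
  rewrite pE jE !linearB /= f1 f2 f3 (W_B v vW) (W_q (B v)) ?(W_rho (B v)) ?W_B //.
  by rewrite (linear0 B) !subr0 sub0r addNr.
have W_S v : piW (S v) = S v by [].
have r_rho v : r (rho v) = r v by rewrite !rE (rho_rho fr).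
have rho_h v : rho (h v) = rho v.
  rewrite hE linearB linearD /= (rho_rho fr) (W_rho (r v)) //.
  by have [_ _ -> _] := W_j _ (W_S (r v)); rewrite addr0 oppr0 addr0.
have h_rho0 v : rho v = 0 -> h v = 0.
  by move=> v0; rewrite hE v0 -r_rho v0 (linear0 r) (linear0 S) (linear0 j) subr0 addr0.
have p_rho v : p (rho v) = 0 by rewrite pE (piW_rho fr) (q_rho fr) linear0 addr0.
have p_h v : p (h v) = r v.
  rewrite hE linearB linearD /= p_rho (W_p (r v)) //.
  by have [_ _ _ ->] := W_j _ (W_S (r v)); rewrite add0r oppr0 addr0.
have q_h v : q (h v) = - S (r v).
  rewrite hE linearB linearD /= (q_rho fr) (W_q (r v)) //.
  by have [_ -> _ _] := W_j _ (W_S (r v)); rewrite add0r sub0r.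
have frame v : v = piW v + f (q v) + rho v := frame_sum fr v.
apply: (@combination_glue F V f piW q S U rho \0 \0 h B j p) => //=.
- by rewrite oppr_eq0.
- exact: piW_piW fr.
- exact: q_piW fr.
- exact: piW_q fr.
- exact: piW_f fr.
- exact: q_f fr.
- by move=> v; rewrite q_ff; congr (_ *: _ + _); rewrite subrr add0r.
- exact: rho_piW fr.
- exact: rho_f fr.
- exact: piW_rho fr.
- by move=> v; rewrite linear0.
- exact: q_rho fr.
- by move=> v; rewrite linear0.
- exact: rho_rho fr.
- by move=> v; rewrite linear0.
- by move=> v; rewrite hE rho_h -(r_rho (h v)) rho_h r_rho -hE.
- by move=> v; rewrite p_h q_h subrr.
- move=> v; apply: h_rho0; rewrite addr0 linearD /= (W_rho (U _)) // add0r.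
  have vW : piW (piW v - S (U (piW v))) = piW v - S (U (piW v)).
    by rewrite linearB /= (piW_piW fr) piW_S.
  by have [_ _ -> _] := W_j _ vW.
- by move=> v; rewrite (h_rho0 (piW v)) ?(rho_piW fr) // !linear0 addr0.
- move=> v; rewrite !linearB !linearZ /= rho_f_rho rho_h (rho_rho fr) p_h r_rho.
  by rewrite rE !scalerN scalerA divff // scale1r subrr !add0r scaleNr.
- move=> v; have [_ _ rj _] := W_j _ (piW_piW fr v).
  by rewrite (h_rho0 _ rj) (linear0 q) (linear0 j) !addr0 scaler0.
- by move=> v; rewrite !(linear0, scaler0, addr0, subr0).
- by move=> v; rewrite addr0.
- by move=> v; rewrite addr0.
Qed.

End PairBasis.

(** * Partition of an infinite set into sequences *)

Lemma infinite_set_seq (T : choiceType) (A : set T) : infinite_set A ->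
  exists g : nat -> T, injective g /\ forall n, A (g n).
Proof.
move=> infA; have [x0 _] := infinite_setN0 infA.
pose pT : pointedType := HB.pack T (isPointed.Build T x0).
have /pcard_leP[g] : ([set: nat] #<= (A : set pT))%card by apply/infiniteP.
exists g; split=> [m n|n]; last exact: (@funS _ _ _ _ g).
by apply: (@inj _ _ _ g); rewrite in_setT.
Qed.

(** A maximal family of disjoint injective sequences in [A] misses only finitely many points, which
    are put in front of one sequence. Every point then has a successor [s x] and a rank [rk x]
    counted from the start of its sequence. *)
Lemma infinite_shift (T : choiceType) (A : set T) : infinite_set A ->
  exists (s pr : T -> T) (rk : T -> nat),
    forall x, A x -> [/\ A (s x), pr (s x) = x & rk (s x) = (rk x).+1].
Proof.
move=> infA.
(* Injectivity of each sequence and disjointness of distinct ones in a single condition. *)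
pose inj_fam (G : set (nat -> T)) := forall r t m n,
  G r -> G t -> r m = t n -> r = t /\ m = n.
pose P := [set G : set (nat -> T) | (forall r n, G r -> A (r n)) /\ inj_fam G]%classic.
have [C sCP totC|G [[GA injG] maxG]] := @Zorn_bigcup _ P.
  split=> [r n [X CX Xr]|r t m n [X CX Xr] [Y CY Yt]]; first exact: (sCP _ CX).1.
  have [sXY|sYX] := totC _ _ CX CY; first by apply: (sCP _ CY).2 => //; apply: sXY.
  by apply: (sCP _ CX).2 => //; apply: sYX.
pose R := [set x | A x /\ forall r n, G r -> r n <> x]%classic.
have finR : finite_set R.
  apply: contrapT => /infinite_set_seq[g [g_inj gR]].
  apply: (maxG (G `|` [set g])%classic).
    split=> [r Gr|]; first by left.
    by move/(_ g (or_intror erefl)) => Gg; case: (gR 0%N) => _ /(_ g 0%N Gg).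
  split=> [r n [/GA//|->]|r t m n [Gr|->] [Gt|->]]; first exact: (gR n).1.
  - exact: injG.
  - by move/((gR n).2 _ _ Gr).
  - by move/esym/((gR m).2 _ _ Gt).
  by move/g_inj.
have [l lR] := iffLR (finite_seqP R) finR.
have [r0 Gr0] : exists r, G r.
  apply: contrapT => nG; apply: infA; apply: sub_finite_set finR => x Ax.
  by split=> // r n Gr; case: nG; exists r.
pose u := undup l; have uR x : (x \in u) <-> R x by rewrite mem_undup lR.
(* The sequence [r0] preceded by the finitely many points left over. *)
pose r1 n := if (n < size u)%N then nth (r0 0%N) u n else r0 (n - size u)%N.
pose G1 := [set r | (G r /\ r <> r0) \/ r = r1]%classic.
have r1P n : R (r1 n) /\ (n < size u)%N \/ (size u <= n)%N /\ r1 n = r0 (n - size u)%N.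
  rewrite /r1; case: ltnP => ltn; [left|by right].
  by split=> //; apply/uR; apply: mem_nth.
have injG1 : inj_fam G1.
  have cross r m n : G r -> r <> r0 -> r m <> r1 n.
    move=> Gr neq; have [[[_ nG] _]|[_ ->]] := r1P n; first exact: nG.
    by case/(injG _ _ _ _ Gr Gr0).
  move=> r t m n [[Gr nr]|->] [[Gt nt]|->].
  - exact: (injG _ _ _ _ Gr Gt).
  - by move/(cross _ _ _ Gr nr).
  - by move/esym/(cross _ _ _ Gt nt).
  have [[Rm ltm]|[lem Em]] := r1P m; have [[Rn ltn]|[len En]] := r1P n.
  - rewrite /r1 ltm ltn => /eqP; rewrite nth_uniq ?undup_uniq // => /eqP //.
  - by rewrite En => /esym eqmn; case: Rm => _ /(_ _ _ Gr0 eqmn).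
  - by rewrite Em => eqmn; case: Rn => _ /(_ _ _ Gr0 eqmn).
  rewrite Em En => /(injG _ _ _ _ Gr0 Gr0)[_ eqmn]; split=> //.
  by rewrite -(subnK lem) eqmn subnK.
have G1A r n : G1 r -> A (r n).
  case=> [[/GA//]|->]; have [[[]//]|[_ ->]] := r1P n.
  exact: GA.
have cover x : exists rn : (nat -> T) * nat, A x -> G1 rn.1 /\ rn.1 rn.2 = x.
  have [[[r n] /= Gr rnx]|nrn] := pselect (exists2 rn, G rn.1 & rn.1 rn.2 = x).
    have [eqr|nr] := pselect (r = r0); last by exists (r, n); split=> //; left.
    exists (r1, n + size u)%N => _; split; first by right.
    by rewrite /= /r1 ltnNge leq_addl /= addnK -eqr.
  exists (r1, index x u) => Ax; split; first by right.
  have xu : x \in u by apply/uR; split=> // r n Gr rnx; case: nrn; exists (r, n).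
  by rewrite /= /r1 index_mem xu nth_index.
have [code codeP] := choice cover.
(* At rank 0 the predecessor is truncated; the claim evaluates it only at [s x], of positive
   rank. *)
exists (fun x => (code x).1 (code x).2.+1), (fun x => (code x).1 (code x).2.-1).
exists (fun x => (code x).2) => x Ax; have [Gx Ex] := codeP x Ax.
have As := G1A _ (code x).2.+1 Gx; have [Gs Es] := codeP _ As.
have [eq1 eq2] := injG1 _ _ _ _ Gs Gx Es.
by split=> //; rewrite eq2 // eq1.
Qed.

(** * The cases of infinitely many pairs and of a quadratic endomorphism *)

Section PairCases.
Variables (F : fieldType) (V : lmodType F).
Implicit Types f g : {linear V -> V}.

Lemma shifted f l : exists g : {linear V -> V}, forall v, g v = f v - l *: v.
Proof. by apply: linear_pack => k x y; rewrite !linearP /=; mod_ring. Qed.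

(** Subtracting the scalar by which f acts on the complement modulo W + L makes the compression of f
    to R vanish, as [combination_pairs] requires. *)
Lemma pair_basis_scalar f (A : set V) :
  indep (pair_vec f) (pair_set A) ->
  (forall x, ~ lspan (pair_vec f) (pair_set A) x ->
     exists m, lspan (pair_vec f) (pair_set A) (f x - m *: x)) ->
  exists (l : F) (f1 piW q rho : {linear V -> V}) (K : set V),
    [/\ forall v, f1 v = f v - l *: v, pair_basis f1 A K, pair_frame f1 piW q rho &
        (forall x, A x -> piW x = x) /\ (forall (E : lmodType F) (g h : {linear V -> E}),
          (forall x, A x -> g x = h x) -> forall v, g (piW v) = h (piW v))]
    /\ forall v, rho (f1 (rho v)) = 0.
Proof.
move=> indA eigA; have [K [_ ind spanT]] := basis_completion (indep_inl indA).
have [l lK] := scalar_mod_complement ind spanT eigA.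
have [f1 f1E] := shifted f l.
have pb := pair_basis_shift ind spanT f1E.
have [piW [q [rho [fr piWA rhoK restrict]]]] := pair_basis_frame pb.
exists l, f1, piW, q, rho, K; split=> //.
have rhoA x : A x -> rho x = 0 by move=> /piWA<-; apply: rho_piW fr _.
have rhof x : A x -> rho (f1 x) = 0 by move=> /piWA<-; apply: rho_f fr _.
have rho0 x : lspan (pair_vec f) (pair_set A) x -> rho x = 0.
  apply: linear_span0 => -[y [] Ay]; rewrite /pair_vec /=; last exact: rhoA.
  by have := rhof y Ay; rewrite f1E linearB linearZ /= (rhoA y) // scaler0 subr0.
have rhoZ x : rho (f1 (rho x)) = (\0 : {linear V -> V}) x.
  apply: (pair_eq pb (g := rho \o f1 \o rho) (h := \0)) => y Ay /=.
  - by rewrite (rhoA y) // !linear0.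
  - by rewrite (rhof y) // !linear0.
  by rewrite (rhoK y) // f1E; apply/rho0/lK.
exact: rhoZ.
Qed.

(** Provides a nonzero coefficient that meets the side condition of [combination_shift]; for l = 0
    the value 1 will do. *)
Lemma nonzero_scalar (l : F) : exists2 a : F, a != 0 & l = 0 \/ l = a.
Proof.
have [->|l_neq0] := eqVneq l 0; first by exists 1; [exact: oner_neq0|left].
by exists l => //; right.
Qed.

(* The shift S has no backward orbit, so that the equation [U, S] = N can be
   solved recursively along its orbits. *)
Lemma decomposable_infinite f (A : set V) :
  indep (pair_vec f) (pair_set A) ->
  (forall x, ~ lspan (pair_vec f) (pair_set A) x ->
     exists m, lspan (pair_vec f) (pair_set A) (f x - m *: x)) ->
  infinite_set A -> decomposable f.
Proof.
move=> indA eigA infA.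
have [l [f1 [piW [q [rho [K [[f1E pb fr [piWA restrict]] rho_f_rho]]]]]]] :=
  pair_basis_scalar indA eigA.
have [a a_neq0 la] := nonzero_scalar l.
(* The commutator to be realised, for the coefficients a, - a, 1, whose sum is 1. *)
have [N NE] : exists N : {linear V -> V}, forall v, N v = a^-1 *: (q (f1 (f1 v)) - v).
  by apply: linear_pack => k x y; rewrite !linearP /=; mod_ring.
have [s [pr [rk shiftP]]] := infinite_shift infA.
have [S [SA Sf SK]] := pair_ext pb s (fun=> 0) (fun=> 0).
(* The recursion U (s x) = N x + S (U x) on the rank, with U = 0 at the start of each sequence;
   [piW] keeps every value in W. *)
pose u := fix u n x := if n is m.+1 then piW (N (pr x) + S (u m (pr x))) else 0.
have [U [UA Uf UK]] := pair_ext pb (fun x => u (rk x) x) (fun=> 0) (fun=> 0).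
have valued (g : {linear V -> V}) : (forall x, A x -> piW (g x) = g x) ->
    (forall x, A x -> g (f1 x) = 0) -> (forall k, K k -> g k = 0) ->
    forall v, piW (g v) = g v.
  move=> gA gf gK; apply: (pair_eq pb (g := piW \o g) (h := g)) => x Ax /=.
  - exact: gA.
  - by rewrite gf // linear0.
  by rewrite gK // linear0.
have piW_S := valued S _ Sf SK; have {}piW_S : forall v, piW (S v) = S v.
  by apply: piW_S => x Ax; rewrite SA // piWA //; case: (shiftP x Ax).
have {}piW_U : forall v, piW (U v) = U v.
  apply: valued => // x Ax; rewrite UA //; case: (rk x) => [|n] /=; first exact: linear0.
  exact: piW_piW fr _.
have comm v : q (f1 (f1 (piW v))) = 1 *: piW v + a *: (U (S (piW v)) - S (U (piW v))).
  have [g gE] : exists g : {linear V -> V},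
      forall v, g v = 1 *: v + a *: (U (S v) - S (U v)).
    by apply: linear_pack => k x y; rewrite !(linearP, linearB) /=; mod_ring.
  rewrite -gE; apply: (restrict _ (q \o f1 \o f1) g) => x Ax /=.
  have [Asx prs rks] := shiftP x Ax.
  have Usx : U (s x) = N x + S (U x).
    rewrite (UA (s x)) // rks /= prs -UA // linearD /= piW_S NE linearZ linearB /=.
    by rewrite (piW_q fr) piWA.
  rewrite gE SA // Usx addrK NE scalerA divff // !scale1r.
  by rewrite addrC subrK.
apply: (combination_shift f1E (combination_pairs a_neq0 (oner_neq0 _) fr _ piW_S piW_U comm)).
  exact: rho_f_rho.
by case: la => ->; [left|right; rewrite !inE eqxx orbT].
Qed.

(** The compression T of f^2 sends each x in [A] to a multiple of x; the relation for x + x0 forces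
    the same factor t throughout, so T = t. As moreover f - l maps V into W + L, nothing outside W +
    L has to be matched. *)
Lemma decomposable_quadratic f (A : set V) :
  indep (pair_vec f) (pair_set A) ->
  (forall x, ~ lspan (pair_vec f) (pair_set A) x ->
     exists m, lspan (pair_vec f) (pair_set A) (f x - m *: x)) ->
  (forall x, exists a b, f (f x) = a *: x + b *: f x) -> decomposable f.
Proof.
move=> indA eigA quad.
have [l [f1 [piW [q [rho [K [[f1E pb fr [piWA restrict]] rho_f_rho]]]]]]] :=
  pair_basis_scalar indA eigA.
have W_q x : A x -> q x = 0 by move=> /piWA<-; apply: q_piW fr _.
have W_rho x : A x -> rho x = 0 by move=> /piWA<-; apply: rho_piW fr _.
have q_fA x : A x -> q (f1 x) = x by move=> /piWA xW; rewrite -{1}xW (q_f fr).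
have rho_fA x : A x -> rho (f1 x) = 0 by move=> /piWA<-; apply: rho_f fr _.
have quad1 x : exists a b, f1 (f1 x) = a *: x + b *: f1 x.
  have [a [b fE]] := quad x; exists (a + l * (b - l)), (b - l - l).
  by rewrite !f1E linearB linearZ /= fE; mod_ring.
have [t tA] : exists t, forall x, A x -> q (f1 (f1 x)) = t *: x.
  have coef x a b : A x -> f1 (f1 x) = a *: x + b *: f1 x -> q (f1 (f1 x)) = b *: x.
    by move=> Ax ->; rewrite linearD !linearZ /= W_q // q_fA // scaler0 add0r.
  have [[x0 Ax0]|nA] := pselect (exists x, A x); last first.
    by exists 0 => x Ax; case: nA; exists x.
  have [a0 [b0 E0]] := quad1 x0; have qE0 := coef _ _ _ Ax0 E0.
  exists b0 => x Ax; have [->//|neqx] := eqVneq x x0.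
  have [a1 [b1 E1]] := quad1 x; have qE1 := coef _ _ _ Ax E1.
  have [a2 [b2 E2]] := quad1 (x + x0).
  (* Compares the f(W)-components of the quadratic relations of x, x0 and x + x0. *)
  have key : b1 *: x + b0 *: x0 = b2 *: (x + x0).
    rewrite -qE1 -qE0 -linearD -!(linearD f1) E2 linearD (linearD f1) !linearZ /=.
    by rewrite !(linearD q) /= (W_q x) // (W_q x0) // !q_fA // addr0 scaler0 add0r.
  have coord y : A y -> b1 *: (y == x)%:R + b0 *: (y == x0)%:R =
      b2 *: ((y == x)%:R + (y == x0)%:R) :> F^o.
    move=> Ay; have [g [gA _ _]] := pair_ext (E := F^o) pb
      (fun z => (y == z)%:R) (fun=> 0) (fun=> 0).
    have := congr1 g key.
    by rewrite (linearD g) !linearZ /= (linearD g) !gA.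
  have := coord _ Ax; have := coord _ Ax0; rewrite !eqxx eq_sym (negPf neqx).
  rewrite !scaler0 add0r addr0 add0r addr0 -![_ *: 1]/(_ * 1) !mulr1 => -> b12.
  by rewrite qE1; congr (_ *: _).
have rho_ff v : rho (f1 (f1 (piW v))) = (\0 : {linear V -> V}) v.
  apply: (restrict _ (rho \o f1 \o f1) \0) => x Ax /=; have [a [b ->]] := quad1 x.
  by rewrite linearD !linearZ /= W_rho // rho_fA // !scaler0 addr0.
(* The three summands of the frame: f W has no part in R by construction, f^2 W by [rho_ff], and f R
   by the choice of l. *)
have rho_f1 v : rho (f1 v) = 0.
  rewrite {1}(frame_sum fr v) !linearD /= (rho_f fr) rho_f_rho -(piW_q fr) rho_ff.
  by rewrite add0r addr0.
have t_piW v : q (f1 (f1 (piW v))) = t *: piW v.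
  have [g gE] : exists g : {linear V -> V}, forall v, g v = t *: v.
    by apply: linear_pack => k x y; rewrite !linearP /=; mod_ring.
  by rewrite -gE; apply: (restrict _ (q \o f1 \o f1) g) => x Ax; rewrite /= gE tA.
have [b b_neq0 lb] := nonzero_scalar (- l).
have [B BE] : exists B : {linear V -> V}, forall v, B v = b *: v.
  by apply: linear_pack => k x y; rewrite !linearP /=; mod_ring.
have [j jE] : exists j : {linear V -> V}, forall v, j v = f1 v - B v.
  by apply: linear_pack => k x y; rewrite !linearP /=; mod_ring.
have [p pE] : exists p : {linear V -> V}, forall v, p v = piW v + B (q v).
  by apply: linear_pack => k x y; rewrite !linearP /=; mod_ring.
pose zero : {linear V -> V} := \0.
(* Only b and c have to be nonzero: b provides - l if l is nonzero, c is 1, and a completes the sum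
   to t. *)
apply: (combination_shift f1E (a := t - b - 1) (b := b) (c := 1)); last first.
  case: lb => [/eqP|->]; first by rewrite oppr_eq0 => /eqP; left.
  by right; rewrite !inE eqxx orbT.
apply: (@combination_glue F V f1 piW q zero zero zero zero zero zero B j p) => //=;
  rewrite /zero /=; try by move=> *; rewrite ?linear0.
- exact: oner_neq0.
- by move=> v; rewrite scaler0 add0r.
- exact: piW_piW fr.
- exact: q_piW fr.
- exact: piW_q fr.
- exact: piW_f fr.
- exact: q_f fr.
- by move=> v; rewrite t_piW; mod_ring.
- by rewrite linear0 addr0.
- by rewrite linear0 addr0.
- by rewrite scaler0 subr0 !linear0 addr0.
- by rewrite (linear0 q) (linear0 j) !addr0 scaler0.
- by rewrite scaler0 subr0 !linear0 addr0.
- by move=> v; rewrite {1}(frame_sum fr (f1 v)) rho_f1 addr0.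
by rewrite !linear0 !addr0.
Qed.
End PairCases.

(** * Cyclic strata of an endomorphism of finite rank modulo scalars *)

Lemma lspan_incl (F : fieldType) (V : lmodType F) (I J : Type) (v : I -> V)
    (w : J -> V) (D : set I) (D' : set J) x :
  (forall i, D i -> lspan w D' (v i)) -> lspan v D x -> lspan w D' x.
Proof.
move=> incl; apply: (@span_elim _ _ _ v (lspan w D')) => //; first exact: span0.
by move=> a y z; apply: spanP.
Qed.

Section Lists.
Variables (F : fieldType) (V : lmodType F).
Implicit Types (us vs ws bs : seq V) (x y : V).

Definition spn us x : Prop := lspan id [set` us]%classic x.

Lemma spn_mem us x : x \in us -> spn us x.
Proof. by move=> ux; apply: (@span_mem _ _ _ id). Qed.

Lemma spn_incl us vs x : (forall u, u \in us -> spn vs u) -> spn us x -> spn vs x.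
Proof. by move=> sub; apply: lspan_incl. Qed.

Lemma spn_sub us vs x : {subset us <= vs} -> spn us x -> spn vs x.
Proof. by move=> sub; apply: spn_incl => u /sub; apply: spn_mem. Qed.

Lemma spn0 us : spn us 0. Proof. exact: span0. Qed.
Lemma spnZ us a x : spn us x -> spn us (a *: x). Proof. exact: spanZ. Qed.
Lemma spnD us x y : spn us x -> spn us y -> spn us (x + y). Proof. exact: spanD. Qed.
Lemma spnB us x y : spn us x -> spn us y -> spn us (x - y). Proof. exact: spanB. Qed.

Lemma spn_nil x : spn [::] x -> x = 0.
Proof.
apply: (@span_elim _ _ _ id (fun x => x = 0)) => // a y z -> ->.
by rewrite scaler0 addr0.
Qed.

Lemma spn_cons u us x : spn (u :: us) x <-> exists a, spn us (x - a *: u).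
Proof.
split=> [|[a sx]].
  apply: (@span_elim _ _ _ id (fun x => exists a, spn us (x - a *: u))).
  - by exists 0; rewrite scale0r subr0; apply: spn0.
  - move=> a y z [b sy] [c sz]; exists (a * b + c).
    rewrite [_ - _](_ : _ = a *: (y - b *: u) + (z - c *: u)); last by mod_ring.
    by apply: spnD => //; apply: spnZ.
  move=> v /=; rewrite inE => /predU1P[->|us_v].
    by exists 1; rewrite scale1r subrr; apply: spn0.
  by exists 0; rewrite scale0r subr0; apply: spn_mem.
rewrite -(subrK (a *: u) x); apply: spnD.
  by apply: spn_sub sx => v; rewrite inE orbC => ->.
by apply/spnZ/spn_mem/mem_head.
Qed.

Lemma spn_rcons u us x : spn (rcons us u) x <-> exists a, spn us (x - a *: u).
Proof.
have eqm : rcons us u =i u :: us by move=> z; rewrite mem_rcons.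
split=> [s|/spn_cons s]; last by apply: spn_sub s => z; rewrite eqm.
by apply/spn_cons; apply: spn_sub s => z; rewrite eqm.
Qed.

Lemma spn_cat_congr us us' vs : (forall x, spn us x <-> spn us' x) ->
  forall x, spn (us ++ vs) x <-> spn (us' ++ vs) x.
Proof.
have half us1 us2 : (forall x, spn us1 x -> spn us2 x) ->
    forall x, spn (us1 ++ vs) x -> spn (us2 ++ vs) x.
  move=> sub x; apply: spn_incl => u; rewrite mem_cat => /orP[/spn_mem/sub|u_vs].
    by apply: spn_sub => z z2; rewrite mem_cat z2.
  by apply: spn_mem; rewrite mem_cat u_vs orbT.
by move=> eq_us x; split; apply: half => y /eq_us.
Qed.

Variable f : {linear V -> V}.

(** Independence of the first n iterates modulo the span of [us], in a form that adjoins them one at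
    a time. *)
Definition chain us y n : Prop :=
  forall j, (j < n)%N -> ~ spn (us ++ traject f y j) (iter j f y).

Lemma chain_congr us us' y n : (forall x, spn us x <-> spn us' x) ->
  chain us y n -> chain us' y n.
Proof.
by move=> eq_us ch j /ch nspn /(spn_cat_congr _ eq_us)/nspn.
Qed.

Lemma iter_peel c x i :
  iter i f (f x - c *: x) = iter i.+1 f x - c *: iter i f x.
Proof. by elim: i => //= i ->; rewrite linearB linearZ. Qed.

(** A unitriangular change of generators: f^i y and f^(i+1) x differ by c f^i x. *)
Lemma peel_span us c x j v :
  spn (us ++ traject f x j.+1) v <->
  spn ((x :: us) ++ traject f (f x - c *: x) j) v.
Proof.
set y := f x - c *: x; split; apply: spn_incl => u; rewrite ?inE mem_cat.
  case/orP=> [us_u|/trajectP[i lti ->]].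
    by apply: spn_mem; rewrite mem_cat inE us_u orbT.
  elim: i lti => [_|i IH lti]; first by apply: spn_mem; rewrite mem_head.
  rewrite -[iter _ _ _](subrK (c *: iter i f x)) -iter_peel.
  apply: spnD; last by apply/spnZ/IH/ltnW.
  by apply: spn_mem; rewrite mem_cat orbC; apply/orP; left; apply/trajectP; exists i.
have traj i : (i <= j)%N -> spn (us ++ traject f x j.+1) (iter i f x).
  move=> lei; apply: spn_mem; rewrite mem_cat orbC; apply/orP; left.
  by apply/trajectP; exists i.
case/or3P=> [/eqP->|us_u|/trajectP[i lti ->]]; first exact: (traj 0%N).
  by apply: spn_mem; rewrite mem_cat us_u.
by rewrite iter_peel; apply: spnB; [|apply: spnZ]; apply: traj => //; apply: ltnW.
Qed.

(* Replacing x by the pair x, (f - c) x lowers the trace of a chain by c. *)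
Lemma chain_peel us x n t c : (0 < n)%N -> chain us x n.+1 ->
  spn (us ++ traject f x n) (iter n.+1 f x - t *: iter n f x) ->
  let y := f x - c *: x in
  [/\ ~ spn us x, chain (x :: us) y n &
   spn ((x :: us) ++ traject f y n.-1) (iter n f y - (t - c) *: iter n.-1 f y)].
Proof.
case: n => // n _ ch rel y; split.
- by have := ch 0%N isT; rewrite cats0.
- move=> j ltj /peel_span; rewrite iter_peel => sy; apply: (ch j.+1) => //.
  rewrite -[iter _ _ _](subrK (c *: iter j f x)); apply: spnD => //.
  apply/spnZ/spn_mem; rewrite mem_cat orbC; apply/orP; left.
  by apply/trajectP; exists j.
apply/peel_span; rewrite !iter_peel.
rewrite [_ - (t - c) *: _](_ : _ = (iter n.+2 f x - t *: iter n.+1 f x) +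
    ((t - c) * c) *: iter n f x); last by mod_ring.
apply: spnD => //; apply/spnZ/spn_mem; rewrite mem_cat orbC; apply/orP; left.
by apply/trajectP; exists n.
Qed.

(** The first members of the h pairs w, f w into which a chain of length 2 h is cut. *)
Definition evens y h := mkseq (fun i => iter i.*2 f y) h.

Lemma mem_evens y h z :
  (z \in evens y h ++ map f (evens y h)) = (z \in traject f y h.*2).
Proof.
rewrite mem_cat; apply/orP/trajectP => [[/mapP[i]|/mapP[w /mapP[i]]]|[i lti ->]].
- by rewrite mem_iota add0n => lti ->; exists i.*2; rewrite ?ltn_double.
- rewrite mem_iota add0n => lti -> ->; exists i.*2.+1 => //.
  by rewrite -doubleS leq_double.
have lti2 : (i./2 < h)%N.
  by rewrite -ltn_double (leq_ltn_trans _ lti) // -{2}[i]odd_double_half leq_addl.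
have mem_half : iter i./2.*2 f y \in evens y h by apply/map_f; rewrite mem_iota.
have -> : iter i f y = iter (odd i + i./2.*2) f y by rewrite odd_double_half.
case: odd; last by left.
by right; rewrite add1n iterS; apply: map_f.
Qed.

End Lists.

Section Configurations.
Variables (F : fieldType) (V : lmodType F) (f : {linear V -> V}).
Implicit Types (us ws bs ks : seq V) (ts : seq F) (x y : V).

Notation vecs ws bs := (ws ++ map f ws ++ bs).
Notation pair_sum A K := (sum_set (pair_set A) K).

(** Independence only sees the sets of entries, so repetitions are excluded separately. *)
Record cfree ws bs : Prop := CFree {
  cfree_indep :
    indep (with_vectors (pair_vec f)) (pair_sum [set` ws]%classic [set` bs]%classic);
  cfree_ws : uniq ws;
  cfree_bs : uniq bs }.

Lemma lspan_vecs ws bs x :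
  lspan (with_vectors (pair_vec f)) (pair_sum [set` ws]%classic [set` bs]%classic) x <->
  spn (vecs ws bs) x.
Proof.
split; last (apply: lspan_incl => u /=); first (apply: lspan_incl => -[[w b] ww|k kb] /=).
- have {}ww : w \in ws by [].
  by apply: spn_mem; rewrite /pair_vec !mem_cat /=; case: b; rewrite ?map_f ?ww ?orbT.
- by apply: spn_mem; rewrite !mem_cat; have -> : k \in bs by []; rewrite !orbT.
rewrite !mem_cat => /or3P[uw|/mapP[w ww ->]|uk].
- exact: (@span_mem _ _ _ (with_vectors (pair_vec f)) _ (inl (u, false))).
- exact: (@span_mem _ _ _ (with_vectors (pair_vec f)) _ (inl (w, true))).
exact: (@span_mem _ _ _ (with_vectors (pair_vec f)) _ (inr u)).
Qed.

Lemma cfree_pair ws bs w : cfree ws bs -> ~ spn (vecs ws bs) w ->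
  ~ spn (rcons (vecs ws bs) w) (f w) -> cfree (rcons ws w) bs.
Proof.
move=> [ind uw ub] nw nfw; split=> //; last first.
  rewrite rcons_uniq uw andbT; apply/negP => ww.
  by apply/nw/spn_mem; rewrite mem_cat ww.
have nw' : ~ lspan (with_vectors (pair_vec f))
    (pair_sum [set` ws]%classic [set` bs]%classic) (with_vectors (pair_vec f) (inl (w, false))).
  by move/lspan_vecs.
have ind1 := indep_add ind nw'.
have nfw' : ~ lspan (with_vectors (pair_vec f))
    (pair_sum [set` ws]%classic [set` bs]%classic `|` [set inl (w, false)])%classic
    (with_vectors (pair_vec f) (inl (w, true))).
  move=> sp; have [a [y [d [/graph_span/lspan_vecs sy fwE _]]]] := graph_add sp.
  by apply: nfw; apply/spn_rcons; exists a; rewrite [f w]fwE addrC addKr.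
apply: indep_sub (indep_add ind1 nfw') => -[[u b]|k] /=; last by left; left.
rewrite /pair_set /= mem_rcons inE => /predU1P[->|uw']; last by left; left.
by case: b; [right|left; right].
Qed.

Lemma cfree_cons ws bs x : cfree ws bs -> ~ spn (vecs ws bs) x -> cfree ws (x :: bs).
Proof.
move=> [ind uw ub] nx; split=> //; last first.
  by rewrite /= ub andbT; apply/negP => xb; apply/nx/spn_mem; rewrite !mem_cat xb !orbT.
have nx' : ~ lspan (with_vectors (pair_vec f))
    (pair_sum [set` ws]%classic [set` bs]%classic) (with_vectors (pair_vec f) (inr x)).
  by move/lspan_vecs.
apply: indep_sub (indep_add ind nx') => -[[u b]|k] /=; first by left.
by rewrite inE => /predU1P[->|kb]; [right|left].
Qed.

Lemma mem_vecs_evens ws bs y h :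
  vecs (ws ++ evens f y h) bs =i vecs ws bs ++ traject f y h.*2.
Proof.
move=> z; rewrite map_cat !mem_cat -mem_evens mem_cat -!orbA.
by do !bool_congr.
Qed.

Lemma spn_eq_mem us us' x : us =i us' -> spn us x -> spn us' x.
Proof. by move=> eq_us; apply: spn_sub => z; rewrite eq_us. Qed.

Lemma cfree_chain ws bs y h :
  cfree ws bs -> chain f (vecs ws bs) y h.*2 -> cfree (ws ++ evens f y h) bs.
Proof.
move=> free; elim: h => [|h IH] ch; first by rewrite /evens /= cats0.
have {}IH : cfree (ws ++ evens f y h) bs.
  by apply: IH => j ltj; apply: ch; rewrite doubleS (ltn_trans ltj).
rewrite /evens mkseqS -rcons_cat; apply: cfree_pair => //.
  move=> /(spn_eq_mem (mem_vecs_evens ws bs y h)); apply: ch.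
  by rewrite doubleS.
move=> s; apply: (ch h.*2.+1); first by rewrite doubleS.
apply: spn_eq_mem s => z; rewrite trajectSr mem_cat !mem_rcons inE.
by rewrite mem_vecs_evens mem_cat !inE; do !bool_congr.
Qed.

(** By [conf_trig], the map T : W -> L = W induced by f^2 is triangular in the basis [ws], with
    diagonal [ts]. *)
Record conf bs ws ts : Prop := Conf {
  conf_free : cfree ws bs;
  conf_size : size ts = size ws;
  conf_trig : forall i, (i < size ws)%N ->
    spn (ws ++ bs ++ map f (take i ws)) (f (f ws`_i) - ts`_i *: f ws`_i) }.

Lemma conf_source bs ws ts x :
  conf bs ws ts -> ~ spn (vecs ws bs) x -> conf (x :: bs) ws ts.
Proof.
move=> [free size_ts trig] nx; split=> // [|i lti]; first exact: cfree_cons.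
by apply: spn_sub (trig i lti) => z; rewrite !mem_cat inE; case/or3P=> ->; rewrite ?orbT.
Qed.

(** For every pair w, f w of the chain but the last, f (f w) is the next vector of [ws], which gives
    the diagonal entry 0; the last pair closes the chain and carries its trace t. *)
Lemma conf_chain bs ws ts y h t :
  conf bs ws ts -> (0 < h)%N -> chain f (vecs ws bs) y h.*2 ->
  spn (vecs ws bs ++ traject f y h.*2.-1) (iter h.*2 f y - t *: iter h.*2.-1 f y) ->
  conf bs (ws ++ evens f y h) (ts ++ rcons (nseq h.-1 0) t).
Proof.
case: h => // h [free size_ts trig] _ ch rel; split.
- exact: cfree_chain.
- by rewrite !size_cat size_ts size_rcons size_nseq size_mkseq.
move=> i; rewrite size_cat size_mkseq => lti.
rewrite !nth_cat take_cat size_ts; case: ltnP => [lti1|lei].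
  by apply: spn_sub (trig i lti1) => z; rewrite !mem_cat; case/or3P=> ->; rewrite ?orbT.
set k := (i - size ws)%N; have ltk : (k < h.+1)%N by rewrite ltn_subLR.
rewrite nth_mkseq // -!iterS map_cat.
have [ltkh|lehk] := ltnP k h.
  rewrite nth_rcons size_nseq ltkh nth_nseq ltkh scale0r subr0 -doubleS.
  apply: spn_mem; rewrite !mem_cat; apply/orP; left; apply/orP; right.
  by apply: (map_f (fun i => iter i.*2 f y)); rewrite mem_iota.
have {lehk ltk} -> : k = h by apply/eqP; rewrite eqn_leq lehk andbT -ltnS.
rewrite nth_rcons size_nseq ltnn eqxx; apply: spn_sub rel => z.
have -> : take h (evens f y h.+1) = evens f y h.
  by rewrite /evens mkseqS -cats1 take_size_cat // size_mkseq.
rewrite -[_.-1]/(h.*2.+1) trajectSr mem_cat mem_rcons inE -mem_evens !mem_cat.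
rewrite /evens mkseqS mem_rcons inE -!orbA.
by do 5?[case/orP=> [->|]]; rewrite ?orbT // => ->; rewrite ?orbT.
Qed.

End Configurations.

(** * Bounding the number of pairs by the rank *)

Section FiniteRank.
Variables (F : fieldType) (V : lmodType F) (f : {linear V -> V}).
Implicit Types (us ws bs ks zs : seq V) (ts : seq F) (x y : V).
Notation vecs ws bs := (ws ++ map f ws ++ bs).

(** One coordinate row serves for all [g], so that families of vectors can be compared through
    matrix products. *)
Lemma spn_coord zs x : spn zs x -> exists c : 'rV[F]_(size zs),
  forall n (g : {linear V -> 'rV[F]_n}), g x = c *m (\matrix_i g zs`_i).
Proof.
apply: (@span_elim _ _ _ id (fun x => exists c : 'rV[F]_(size zs),
  forall n (g : {linear V -> 'rV[F]_n}), g x = c *m (\matrix_i g zs`_i))).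
- by exists 0 => n g; rewrite linear0 mul0mx.
- move=> a y z [c cP] [d dP]; exists (a *: c + d) => n g.
  by rewrite linearP cP dP mulmxDl scalemxAl.
move=> z /= zzs; have lti : (index z zs < size zs)%N by rewrite index_mem.
by exists (delta_mx 0 (Ordinal lti)) => n g; rewrite -rowE rowK /= nth_index.
Qed.

(** The functionals dual to the vectors f w send the vectors f w - l w to an identity matrix, which
    factors through the coordinates in [zs]. *)
Lemma pairs_bound l zs ws bs :
  (forall v, spn zs (f v - l *: v)) -> cfree f ws bs -> (size ws <= size zs)%N.
Proof.
move=> rk [ind uw _]; pose n := size ws.
have [g gE] := linear_ext_indep (E := 'rV[F]_n) (fun i => match i with
  | inl (w, true) => \row_j ((j : nat) == index w ws)%:R | _ => 0 end) ind.
have [C CP] := choice (fun i : 'I_n => spn_coord (rk ws`_i)).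
have ws_i (i : 'I_n) : ws`_i \in ws by rewrite mem_nth.
apply: (@mulmx1_min F _ _ (\matrix_i C i) (\matrix_i g zs`_i)).
apply/row_matrixP => i; rewrite row_mul rowK -CP linearB linearZ /=.
rewrite (gE (inl (ws`_i, true))) ?(gE (inl (ws`_i, false))) //; try exact: ws_i.
by apply/rowP => j; rewrite scaler0 subr0 !mxE index_uniq // eq_sym.
Qed.

(** f - l maps W + L into the span of [A], f A and f^2 A, and the complement into W + L. *)
Lemma finite_pairs_rank (A : set V) :
  indep (pair_vec f) (pair_set A) ->
  (forall x, ~ lspan (pair_vec f) (pair_set A) x ->
     exists m, lspan (pair_vec f) (pair_set A) (f x - m *: x)) ->
  finite_set A -> exists l zs, forall v, spn zs (f v - l *: v).
Proof.
move=> indA eigA finA; have [ra raA] := iffLR (finite_seqP A) finA.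
have [K [_ ind spanT]] := basis_completion (indep_inl indA).
have [l lK] := scalar_mod_complement ind spanT eigA.
pose zs := ra ++ map f ra ++ map f (map f ra); exists l, zs => v.
have mem_ra x : A x -> x \in ra by rewrite raA.
have zs0 x : A x -> spn zs x.
  by move=> /mem_ra xra; apply: spn_mem; rewrite mem_cat xra.
have zs1 x : A x -> spn zs (f x).
  by move=> /mem_ra xra; apply: spn_mem; rewrite !mem_cat (map_f f xra) orbT.
have zs2 x : A x -> spn zs (f (f x)).
  by move=> /mem_ra xra; apply: spn_mem; rewrite !mem_cat (map_f f (map_f f xra)) !orbT.
move: (spanT v); apply: (@span_elim _ _ _ _ (fun v => spn zs (f v - l *: v))).
- by rewrite linear0 scaler0 subrr; apply: spn0.
- move=> a x y sx sy; rewrite [_ - _](_ : _ = a *: (f x - l *: x) + (f y - l *: y)).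
    exact: spanP.
  by rewrite (linearP f); mod_ring.
case=> [[x []] Ax|k Kk] /=.
- by apply: spnB; [apply: zs2|apply/spnZ/zs1].
- by apply: spnB; [apply: zs1|apply/spnZ/zs0].
apply: lspan_incl (lK k Kk) => -[x []] Ax; rewrite /pair_vec /=; [exact: zs1|exact: zs0].
Qed.

End FiniteRank.

Section Strata.
Variables (F : fieldType) (V : lmodType F) (f : {linear V -> V}).
Implicit Types (us ws bs ks zs : seq V) (ts : seq F) (x y : V) (U : V -> Prop).
Notation vecs ws bs := (ws ++ map f ws ++ bs).

(* x0 is the first vector of the first stratum; it is followed by an element of ws if
   par holds and by an element of ks otherwise. *)
Record config (par : bool) U (k m : nat) (t d c : F) : Prop := Config {
  config_data : exists x0 ws ks ts,
    [/\ conf f (rcons ks x0) ws ts, size ws = k, size ks = m &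
       \sum_(s <- ts) s = t - c *+ m - d] /\
    [/\ forall v, U v <-> spn (vecs ws (rcons ks x0)) v,
       forall y, y \in ks -> spn ws (f y - c *: y) &
       spn (if par then ws else ks) (f x0 - d *: x0)] }.

(* The strata, hence U, k, m and t, are chosen first; the diagonal entry d of the very
   first vector x0, and the common diagonal entry c of the first vectors ks of the
   other odd strata, may then be prescribed. *)
Definition stratified par U k m t := forall d c, config par U k m t d c.

Variables (l : F) (zs : seq V).
Hypothesis rank_f : forall v, spn zs (f v - l *: v).

(** An endless chain would yield arbitrarily many pairs, against [pairs_bound]. *)
Lemma chain_stops ws bs y : cfree f ws bs -> exists2 n,
  chain f (vecs ws bs) y n & spn (vecs ws bs ++ traject f y n) (iter n f y).
Proof.
move=> free; apply: contrapT => nstop.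
have ch n : chain f (vecs ws bs) y n.
  elim: n => // n IH j; rewrite ltnS leq_eqVlt => /predU1P[->|/IH//] s.
  by apply: nstop; exists n.
have := pairs_bound rank_f (cfree_chain free (ch (size zs).+1.*2)).
by rewrite size_cat size_mkseq addnS ltnNge leq_addl.
Qed.

Lemma chain_trace us y n : spn (us ++ traject f y n.+1) (iter n.+1 f y) ->
  exists t, spn (us ++ traject f y n) (iter n.+1 f y - t *: iter n f y).
Proof. by rewrite trajectSr -rcons_cat => /spn_rcons. Qed.

Lemma sum_rcons_nseq0 (n : nat) (t : F) : \sum_(s <- rcons (nseq n 0) t) s = t.
Proof.
rewrite -cats1 big_cat /= big_seq1 big_nseq.
by elim: n => [|n IH] /=; rewrite ?add0r // addr0 -{2}IH add0r.
Qed.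

Lemma conf_nil : conf f [::] [::] [::].
Proof.
split=> //; split=> //.
by apply: indep_sub (@indep_set0 F V _ (with_vectors (pair_vec f))) => -[].
Qed.

(** The stratum generated by x has dimension n + 1 at least 3. In odd dimension x is peeled off, in
    even dimension also y = f x - d x, which goes to [ks]; what remains has positive even length and
    is cut into pairs. *)
Lemma stratified_init x : (forall a b, f (f x) <> a *: x + b *: f x) ->
  exists par U k m t, stratified par U k m t /\ (0 < k)%N.
Proof.
move=> indx; have [n ch stop] := chain_stops x (conf_free conf_nil).
have n_gt2 : (2 < n)%N.
  rewrite ltnNge; apply/negP; case: n stop {ch} => [|[|[|//]]] /=.
  - by move/spn_nil=> x0; case: (indx 0 0); rewrite x0 !linear0 addr0.
  - case/spn_cons=> a /spn_nil/subr0_eq fx _; case: (indx 0 a).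
    by rewrite scale0r add0r {1}fx linearZ.
  case/spn_cons=> a /spn_cons[b /spn_nil/subr0_eq fx] _; case: (indx a b).
  by rewrite -fx addrC subrK.
case: n n_gt2 ch stop => [//|n] n_gt1 ch /chain_trace[t rel].
have n_gt0 : (0 < n)%N := ltnW n_gt1.
pose U v := spn (traject f x n.+1) v; rewrite /= in ch rel.
have [h [n_h|n_h]] : exists h, n = h.*2 \/ n = h.*2.+1.
- by exists n./2; rewrite -{1 3}[n]odd_double_half; case: odd; [right|left].
- exists true, U, h, 0%N, t; split=> [d c|]; last by rewrite -double_gt0 -n_h.
  have [nx chy rely] := chain_peel d n_gt0 ch rel; rewrite n_h in chy rely n_gt0.
  have h_gt0 : (0 < h)%N by rewrite -double_gt0.
  have cf := conf_chain (conf_source conf_nil nx) h_gt0 chy rely.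
  split; exists x, (evens f (f x - d *: x) h), [::], (rcons (nseq h.-1 0) (t - d)).
  split; split=> //; first by rewrite size_mkseq.
  + by rewrite sum_rcons_nseq0 mulr0n subr0.
  + move=> v; rewrite /U n_h; split=> [/(peel_span f [::] d x)|].
      by apply: spn_eq_mem => z; rewrite (mem_vecs_evens f [::] [:: x]).
    move=> s; apply/(peel_span f [::] d x); apply: spn_eq_mem s => z.
    by rewrite (mem_vecs_evens f [::] [:: x]).
  by apply/spn_mem/mapP; exists 0%N => //; rewrite mem_iota.
have h_gt0 : (0 < h)%N by move: n_gt1; rewrite n_h !ltnS double_gt0.
exists false, U, h, 1%N, t; split=> [d c|//].
have [nx chy rely] := chain_peel d n_gt0 ch rel; rewrite n_h in chy rely.
have h2_gt0 : (0 < h.*2)%N by rewrite double_gt0.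
have [ny chz relz] := chain_peel c h2_gt0 chy rely.
set y := f x - d *: x in ny chz relz; set z := f y - c *: y in chz relz.
have cf := conf_chain (conf_source (conf_source conf_nil nx) ny) h_gt0 chz relz.
split; exists x, (evens f z h), [:: y], (rcons (nseq h.-1 0) (t - d - c)).
split; split=> //; first by rewrite size_mkseq.
- by rewrite sum_rcons_nseq0 mulr1n addrAC.
- have eqv v : spn (vecs (evens f z h) [:: y; x]) v <-> spn ([:: y; x] ++ traject f z h.*2) v.
    by split; apply: spn_eq_mem => w; rewrite (mem_vecs_evens f [::] [:: y; x]).
  move=> v; rewrite /U n_h; split=> [/(peel_span f [::] d x)/(peel_span f [:: x] c y)/eqv//|].
  by move/eqv/(peel_span f [:: x] c y)/(peel_span f [::] d x).
- move=> u; rewrite inE => /eqP->.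
  by apply/spn_mem/mapP; exists 0%N => //; rewrite mem_iota.
by apply/spn_mem; rewrite inE.
Qed.

(** U is stable under f, so x, which is no eigenvector modulo U, generates a stratum of dimension at
    least 2 over U. In odd dimension its first vector goes to [ks]; the rest is cut into pairs. *)
Lemma stratified_step par U k m t x :
  stratified par U k m t -> (forall a, ~ U (f x - a *: x)) ->
  exists U' k' m' t', stratified par U' k' m' t' /\ (k < k')%N.
Proof.
(* Any d and c describe the same U; at 0 its stability under f is easily read off. *)
move=> strat nUx; have [[x0 [ws0 [ks0 [ts0 [[cf0 sz0 szk0 _] [U0 K0 X0]]]]]]] := strat 0 0.
set us0 := vecs _ _ in U0.
have us0_bs z : z \in rcons ks0 x0 -> spn us0 z.
  by move=> z_bs; apply: spn_mem; rewrite !mem_cat z_bs !orbT.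
have us0_ws z : z \in ws0 -> spn us0 z.
  by move=> z_ws; apply: spn_mem; rewrite mem_cat z_ws.
have us0_fws z : z \in ws0 -> spn us0 (f z).
  by move=> z_ws; apply: spn_mem; rewrite !mem_cat (map_f f z_ws) orbT.
have ks_bs z : z \in ks0 -> z \in rcons ks0 x0.
  by move=> z_ks; rewrite mem_rcons inE z_ks orbT.
have Uf v : U v -> U (f v).
  move=> /U0 s; apply/U0; move: s; apply: (@span_elim _ _ _ id (fun v => spn us0 (f v))).
  - by rewrite linear0; apply: spn0.
  - by move=> a y z sy sz; rewrite linearP; apply: spanP.
  move=> u /=; rewrite !mem_cat => /or3P[/us0_fws//|/mapP[w w_ws ->]|].
    have ltw : (index w ws0 < size ws0)%N by rewrite index_mem.
    have := conf_trig cf0 ltw; rewrite nth_index // => trig.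
    rewrite -(subrK (ts0`_(index w ws0) *: f w) (f (f w))).
    apply: spnD; last exact/spnZ/us0_fws.
    apply: spn_sub trig => z; rewrite !mem_cat => /or3P[->//|->|].
      by rewrite !orbT.
    by move=> /mapP[y /mem_take y_ws ->]; rewrite (map_f f y_ws) orbT.
  rewrite mem_rcons inE => /predU1P[->|u_ks].
    rewrite -[f x0]subr0 -(scale0r x0); apply: spn_incl X0 => z; case: (par).
      exact: us0_ws.
    by move=> /ks_bs/us0_bs.
  rewrite -[f u]subr0 -(scale0r u); apply: spn_incl (K0 u u_ks) => z; exact: us0_ws.
have [n ch stop] := chain_stops x (conf_free cf0); rewrite -/us0 in ch stop.
have n_gt1 : (1 < n)%N.
  rewrite ltnNge; apply/negP; case: n stop {ch} => [|[|//]] /=.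
    rewrite cats0 => /U0/Uf Ufx _; apply: (nUx 0).
    by rewrite scale0r subr0.
  by rewrite cats1 => /spn_rcons[a /U0 Ua] _; apply: (nUx a).
case: n n_gt1 ch stop => [//|n] n_gt0 ch /chain_trace[s rel]; rewrite ltnS in n_gt0.
pose U' v := spn (us0 ++ traject f x n.+1) v.
have [h [n_h|n_h]] : exists h, n.+1 = h.*2 \/ n = h.*2.
- have [odd_n|even_n] := boolP (odd n).
    by exists n./2.+1; left; rewrite -{1}[n]odd_double_half odd_n.
  by exists n./2; right; rewrite -{1}[n]odd_double_half (negPf even_n).
- have h_gt0 : (0 < h)%N by rewrite -double_gt0 -n_h.
  exists U', (k + h)%N, m, (t + s); split; last by rewrite -addn1 leq_add2l.
  move=> d c; have [[y0 [ws [ks [ts [[cf sz_ws sz_ks sum_ts] [eqU K X]]]]]]] := strat d c.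
  set us := vecs _ _ in eqU; have eq_us v : spn us0 v <-> spn us v.
    by rewrite -U0 -eqU.
  (* Length and trace of the new chain depend only on the span U, so they carry over to the vectors
     belonging to the prescribed d and c. *)
  have ch' := chain_congr eq_us ch; have rel' := iffLR (spn_cat_congr _ eq_us _) rel.
  rewrite n_h in ch'; have {}rel' : spn (us ++ traject f x h.*2.-1)
    (iter h.*2 f x - s *: iter h.*2.-1 f x) by rewrite -n_h.
  have cf' := conf_chain cf h_gt0 ch' rel'.
  split; exists y0, (ws ++ evens f x h), ks, (ts ++ rcons (nseq h.-1 0) s).
  split; split=> //.
  + by rewrite size_cat size_mkseq sz_ws.
  + by rewrite big_cat /= sum_ts sum_rcons_nseq0; ring.
  + move=> v; rewrite /U' n_h (spn_cat_congr _ eq_us).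
    by split; apply: spn_eq_mem => z; rewrite mem_vecs_evens.
  + by move=> y /K; apply: spn_sub => z; rewrite mem_cat => ->.
  by case: (par) X => // X; apply: spn_sub X => z; rewrite mem_cat => ->.
have h_gt0 : (0 < h)%N by rewrite -double_gt0 -n_h.
exists U', (k + h)%N, m.+1, (t + s); split; last by rewrite -addn1 leq_add2l.
move=> d c; have [[y0 [ws [ks [ts [[cf sz_ws sz_ks sum_ts] [eqU K X]]]]]]] := strat d c.
set us := vecs _ _ in eqU; have eq_us v : spn us0 v <-> spn us v.
  by rewrite -U0 -eqU.
have ch' := chain_congr eq_us ch; have rel' := iffLR (spn_cat_congr _ eq_us _) rel.
have [nx chy rely] := chain_peel c n_gt0 ch' rel'; rewrite n_h in chy rely.
set y := f x - c *: x in chy rely.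
have eq_mem : x :: us =i vecs ws (x :: rcons ks y0).
  by move=> z; rewrite inE !mem_cat inE; do !bool_congr.
have eq_us2 v : spn (x :: us) v <-> spn (vecs ws (x :: rcons ks y0)) v.
  by split; apply: spn_eq_mem => z; rewrite eq_mem.
have cf' := conf_chain (conf_source cf nx) h_gt0 (chain_congr eq_us2 chy)
  (iffLR (spn_cat_congr _ eq_us2 _) rely).
split; exists y0, (ws ++ evens f y h), (x :: ks), (ts ++ rcons (nseq h.-1 0) (s - c)).
split; split=> //.
- by rewrite size_cat size_mkseq sz_ws.
- by rewrite /= sz_ks.
- by rewrite big_cat /= sum_ts sum_rcons_nseq0 mulrSr; ring.
- move=> v; rewrite /U' n_h (spn_cat_congr _ eq_us) (peel_span f us c x) (spn_cat_congr _ eq_us2).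
  by split; apply: spn_eq_mem => z; rewrite mem_vecs_evens.
- move=> z; rewrite inE => /predU1P[->|z_ks].
    apply: spn_mem; rewrite mem_cat; apply/orP; right.
    by apply/mapP; exists 0%N => //; rewrite mem_iota.
  by apply: spn_sub (K z z_ks) => w; rewrite mem_cat => ->.
case: (par) X => X; first by apply: spn_sub X => z; rewrite mem_cat => ->.
by apply: spn_sub X => z; rewrite inE orbC => ->.
Qed.

(** Each new stratum increases the number k of pairs, which [pairs_bound] limits. *)
Lemma stratified_terminal par U k m t : stratified par U k m t -> (0 < k)%N ->
  exists U k m t, [/\ stratified par U k m t, (0 < k)%N &
    forall x, exists a, U (f x - a *: x)].
Proof.
move=> strat k_gt0; apply: contrapT => nterm.
have large j : exists U k m t, stratified par U k m t /\ (j < k)%N.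
  elim: j => [|j [U1 [k1 [m1 [t1 [strat1 lt_j]]]]]]; first by exists U, k, m, t.
  have [x nx] : exists x, forall a, ~ U1 (f x - a *: x).
    apply: contrapT => nx; apply: nterm; exists U1, k1, m1, t1; split=> //.
      exact: leq_ltn_trans lt_j.
    by move=> x; apply: contrapT => na; apply: nx; exists x => a Ua; apply: na; exists a.
  have [U2 [k2 [m2 [t2 [strat2 lt2]]]]] := stratified_step strat1 nx.
  by exists U2, k2, m2, t2; split=> //; apply: leq_ltn_trans lt2.
have [U1 [k1 [m1 [t1 [strat1 lt1]]]]] := large (size zs).
have [[x0 [ws [ks [ts [[cf sz _ _] _]]]]]] := strat1 0 0.
by have := pairs_bound rank_f (conf_free cf); rewrite sz leqNgt lt1.
Qed.

End Strata.

(** Over the field of two elements a = b = c = 1 is forced and [eps] adjusts the sum. Over a larger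
    field two nonzero coefficients suffice to solve for two unknowns, and the third takes a value
    that serves l. *)
Lemma solve_coefficients (F : fieldType) (al be ga t l : F) :
  (be = 0 -> al = 0 \/ al + 1 = 0) ->
  exists (eps : bool) (a b c : F), [/\ a != 0, b != 0, c != 0,
    (al + eps%:R) * a + be * b + ga * c = t & l = 0 \/ l \in [:: a; b; c]].
Proof.
move=> be0; have [[z [z0 z1]]|small] := pselect (exists z : F, z != 0 /\ z != 1); last first.
  have bit (z : F) : exists e : bool, z = e%:R.
    have [->|z0] := eqVneq z 0; first by exists false.
    exists true; apply: contrapT => z1; apply: small; exists z; split=> //.
    exact/eqP.
  have [eps epsE] := bit (t - al - be - ga); have [e eE] := bit l.
  exists eps, 1, 1, 1; split; rewrite ?oner_neq0 //; first by rewrite -epsE; ring.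
  by rewrite eE; case: e {eE}; [right; rewrite mem_head|left].
have avoid (u : F) : exists2 a : F, a != 0 & a != u.
  have [->|u1] := eqVneq u 1; first by exists z.
  by exists 1; rewrite ?oner_neq0 // eq_sym.
(* The unknown a has to avoid 0 and s / A, which takes a third element of the field. *)
have two (A B s : F) : A != 0 -> B != 0 ->
    exists a b, [/\ a != 0, b != 0 & A * a + B * b = s].
  move=> A0 B0; have [a a0 aA] := avoid (s / A).
  exists a, ((s - A * a) / B); split=> //; last by rewrite (mulrC B) divfK // addrC subrK.
  rewrite mulf_neq0 ?invr_eq0 // subr_eq0; apply: contra_neq aA => ->.
  by rewrite mulrC mulKf.
have [m m0 lm] := nonzero_scalar l.
have lmem (a b c : F) : m \in [:: a; b; c] -> l = 0 \/ l \in [:: a; b; c].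
  by case: lm => ->; [left|right].
have [eps eps0] : exists eps : bool, al + eps%:R != 0.
  have [->|al0] := eqVneq al 0; first by exists true; rewrite add0r oner_neq0.
  by exists false; rewrite addr0.
have [be_eq0|be_neq0] := eqVneq be 0; last first.
  have [a [b [a0 b0 eq_s]]] := two _ _ (t - ga * m) eps0 be_neq0.
  exists eps, a, b, m; split=> //; last by apply: lmem; rewrite !inE eqxx !orbT.
  by rewrite eq_s subrK.
have [ga_eq0|ga_neq0] := eqVneq ga 0; last first.
  have [a [c [a0 c0 eq_s]]] := two _ _ (t - be * m) eps0 ga_neq0.
  exists eps, a, m, c; split=> //; last by apply: lmem; rewrite !inE eqxx orbT.
  by rewrite addrAC eq_s subrK.
have [t_eq0|t_neq0] := eqVneq t 0; last first.
  exists eps, (t / (al + eps%:R)), m, m; split=> //.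
  - by rewrite mulf_neq0 ?invr_eq0 ?eps0.
  - by rewrite be_eq0 ga_eq0 !mul0r !addr0 (mulrC _ (t / _)) divfK.
  by apply: lmem; rewrite !inE eqxx !orbT.
(* Now be = ga = t = 0, and the hypothesis lets [eps] cancel the coefficient of a. *)
have [e al_e] : exists e : bool, al + e%:R = 0.
  by case: (be0 be_eq0) => al0; [exists false; rewrite addr0|exists true].
exists e, m, m, m; split=> //; last by apply: lmem; rewrite mem_head.
by rewrite al_e be_eq0 ga_eq0 t_eq0 !mul0r !addr0.
Qed.

(** * Commutators with a nilpotent shift *)

Section TriangularCommutator.
Variables (F : fieldType) (V : lmodType F) (f piW : {linear V -> V}).
Variables (ws : seq V) (K : set V) (N : {linear V -> V}) (xi : {linear V -> F^o}).
Variable n : nat -> F.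
Hypotheses (uniq_ws : uniq ws) (pb : pair_basis f [set` ws]%classic K).
Hypothesis (piWA : forall x, x \in ws -> piW x = x).
Hypothesis (piW_N : forall v, piW (N v) = N v).
Hypothesis N_trig : forall i, (i < size ws)%N ->
  spn (take i ws) (N ws`_i - n i *: ws`_i).
Hypothesis trace_N : \sum_(i < size ws) n i = 0.

(* With S w_i = w_(i-1), the equation [U, S] = N determines U by descending
   induction from the image Y of the last vector; the only obstruction is the
   trace of N, and Y can be chosen to prescribe the first row of U. *)
Lemma triangular_commutator : exists (S U : {linear V -> V}) (psi : {linear V -> F^o}),
  [/\ forall v, piW (S v) = S v, forall v, piW (U v) = U v,
      forall w, w \in ws -> U (S w) - S (U w) = N w &
      forall w, w \in ws -> psi (U w) = xi w].
Proof.
have [k_eq0|k_gt0] := posnP (size ws).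
  exists \0, \0, \0; split=> [v|v|w|w] /=; rewrite ?linear0 //;
    by rewrite (size0nil k_eq0).
pose k := size ws.
have [S [SA Sf SK]] := pair_ext pb
  (fun x => if index x ws is j.+1 then ws`_j else 0) (fun=> 0) (fun=> 0).
have [psi [psiA psif psiK]] := pair_ext (E := F^o) pb
  (fun x => (index x ws == 0%N)%:R) (fun=> 0) (fun=> 0).
have ws_mem i : (i < k)%N -> ws`_i \in ws by move=> lti; rewrite mem_nth.
have S0 : S ws`_0 = 0 by rewrite SA ?index_uniq //; apply: ws_mem.
have SS i : (i.+1 < k)%N -> S ws`_i.+1 = ws`_i.
  by move=> lti; rewrite SA ?index_uniq //; apply: ws_mem.
have psi_ws i : (i < k)%N -> psi ws`_i = (i == 0%N)%:R.
  by move=> lti; rewrite psiA ?index_uniq //; apply: ws_mem.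
have iterS_lin d : exists g : {linear V -> V}, forall v, g v = iter d S v.
  elim: d => [|d [g gE]]; first by exists idfun.
  by exists (S \o g) => v; rewrite /= gE.
have iterS_ws d i : (i < k)%N -> iter d S ws`_i = if (d <= i)%N then ws`_(i - d) else 0.
  move=> lti; elim: d => [|d IH]; first by rewrite subn0.
  rewrite iterS IH; case: (ltnP d i) => [ltd|led].
    have eq_sub := subnSK ltd; rewrite (ltnW ltd) -eq_sub SS // eq_sub.
    exact: leq_ltn_trans (leq_subr _ _) lti.
  case: (leqP d i) => [ged|_]; last exact: linear0.
  have -> : d = i by apply/eqP; rewrite eqn_leq led ged.
  by rewrite subnn.
(* [u Y d] is to be U w_(k-1-d), starting from U w_(k-1) = Y. The value [u Y k], one place before
   w_0, has to vanish because S w_0 = 0. *)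
pose u Y := fix u d := if d is e.+1 then N ws`_(k.-1 - e) + S (u e) else Y : V.
pose z := u 0.
have iterS0 d : iter d S 0 = 0.
  by have [g gE] := iterS_lin d; rewrite -gE linear0.
have uE Y d : u Y d = iter d S Y + z d.
  elim: d => [|d IH] /=; first by rewrite addr0.
  by rewrite IH linearD /=; mod_ring.
have iterS_z d : (d <= k)%N -> iter (k - d) S (z d) =
    (\sum_(e < d) n (k.-1 - e)%N) *: ws`_0.
  elim: d => [|d IH] ltd; first by rewrite big_ord0 scale0r iterS0.
  rewrite big_ord_recr /= scalerDl -IH 1?ltnW // -(subnSK ltd) iterSr.
  have [g gE] := iterS_lin (k - d.+1)%N; rewrite -!gE linearD /= addrC.
  congr (_ + _); set i := (k.-1 - d)%N.
  have lti : (i < k)%N by rewrite (leq_ltn_trans (leq_subr _ _)) // prednK.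
  have i_eq : (k - d.+1)%N = i by rewrite /i -subn1 -subnDA add1n.
  (* S^i kills every w_j with j < i and sends w_i to w_0, so only the diagonal entry of N
     survives. *)
  have g_lower : g (N ws`_i - n i *: ws`_i) = 0.
    apply: linear_span0 (N_trig lti) => x /= /(nthP 0)[j].
    rewrite size_take lti => ltj; rewrite nth_take // => <-.
    by rewrite gE i_eq iterS_ws ?(ltn_trans ltj) // leqNgt ltj.
  rewrite -(subrK (n i *: ws`_i) (N ws`_i)) (linearD g) g_lower add0r linearZ /=.
  by rewrite gE i_eq iterS_ws // leqnn subnn.
have z_k : z k = 0.
  have := iterS_z k (leqnn k); rewrite subnn /= => ->.
  rewrite [\sum_(e < k) _](_ : _ = 0) ?scale0r // -[RHS]trace_N.
  rewrite [RHS](reindex_inj rev_ord_inj) /=; apply: eq_bigr => i _; congr n.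
  by rewrite -subn1 -subnDA add1n.
(* The w_0-coordinate of S^j Y is the j-th coordinate of Y, so Y can correct [psi] of every [u Y j]
   separately. *)
pose y j := xi ws`_(k.-1 - j) - psi (z j).
pose Y := \sum_(j < k) y j *: ws`_j.
have iterS_Y d : iter d S Y = \sum_(j < k) y j *: iter d S ws`_j.
  by have [g gE] := iterS_lin d; rewrite -gE linear_sum; apply: eq_bigr => j _;
    rewrite linearZ /= gE.
have u_k : u Y k = 0.
  rewrite uE z_k addr0 iterS_Y big1 // => j _.
  by rewrite iterS_ws // leqNgt ltn_ord scaler0.
have psi_u d : (d < k)%N -> psi (u Y d) = xi ws`_(k.-1 - d).
  move=> ltd; rewrite uE linearD /= iterS_Y linear_sum (bigD1 (Ordinal ltd)) //=.
  rewrite iterS_ws // leqnn subnn linearZ /= psi_ws // big1 => [|j neqj].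
    by rewrite addr0 [_ *: _]mulr1 subrK.
  rewrite linearZ /= iterS_ws //; case: leqP => [led|_]; last by rewrite linear0 scaler0.
  rewrite psi_ws ?(leq_ltn_trans (leq_subr _ _)) // subn_eq0 leqNgt ltn_neqAle led andbT.
  by rewrite eq_sym neqj scaler0.
have [U [UA Uf UK]] := pair_ext pb (fun x => u Y (k.-1 - index x ws)%N) (fun=> 0) (fun=> 0).
have Uws i : (i < k)%N -> U ws`_i = u Y (k.-1 - i)%N.
  by move=> lti; rewrite UA ?index_uniq //; apply: ws_mem.
have valued (g : {linear V -> V}) : (forall x, x \in ws -> piW (g x) = g x) ->
    (forall x, x \in ws -> g (f x) = 0) -> (forall x, K x -> g x = 0) ->
    forall v, piW (g v) = g v.
  move=> gA gf gK; apply: (pair_eq pb (g := piW \o g) (h := g)) => x Ax /=.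
  - exact: gA.
  - by rewrite gf // linear0.
  by rewrite gK // linear0.
have piW_S v : piW (S v) = S v.
  apply: valued => // x xws; rewrite SA //; case E: (index x ws) => [|j].
    exact: linear0.
  by apply/piWA/ws_mem; rewrite ltnW // -E index_mem.
exists S, U, psi; split=> //.
- apply: valued => // x xws; rewrite UA //; elim: (_ - _)%N => [|d IH] /=.
    by rewrite /Y linear_sum; apply: eq_bigr => j _; rewrite linearZ /= piWA ?ws_mem.
  by rewrite linearD /= piW_N piW_S.
- move=> w w_ws; have lti : (index w ws < k)%N by rewrite index_mem.
  rewrite -(nth_index 0 w_ws); case: (index w ws) lti => [|i] lti.
    rewrite S0 linear0 sub0r Uws // subn0; have := u_k.
    by rewrite -{1}(prednK (k_gt0 : (0 < k)%N)) /= subnn => /eqP; rewrite addr_eq0 => /eqP->.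
  rewrite SS // !Uws ?(ltnW lti) //.
  have lti' : (i < k.-1)%N by rewrite -ltnS prednK.
  by rewrite -(subnSK lti') /= subKn ?addrK.
move=> w w_ws; have lti : (index w ws < k)%N by rewrite index_mem.
rewrite -{1}(nth_index 0 w_ws) Uws // psi_u ?subKn ?nth_index //.
  by rewrite -ltnS prednK.
by rewrite (leq_ltn_trans (leq_subr _ _)) // prednK.
Qed.

End TriangularCommutator.

Section FrameGlue.
Variables (F : fieldType) (V : lmodType F).

(** The glueing for an h with values in R, where p h and q h vanish; [r1] and [r2] distribute R
    between the two blocks. *)
Lemma combination_frame (f piW q rho S U r1 r2 theta h B j p : {linear V -> V})
    (a b c : F) :
  b != 0 -> c != 0 -> pair_frame f piW q rho ->
  (forall v, B v = a *: U (S v) + b *: v) ->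
  (forall v, j v = f v - B v) -> (forall v, p v = piW v + B (q v)) ->
  (forall v, piW (S v) = S v) -> (forall v, piW (U v) = U v) ->
  (forall v, q (f (f (piW v))) =
     (a + b + c) *: piW v + a *: (U (S (piW v)) - S (U (piW v)))) ->
  (forall v, r1 (rho v) = r1 v) -> (forall v, rho (r1 v) = r1 v) ->
  (forall v, r2 (rho v) = r2 v) -> (forall v, rho (r2 v) = r2 v) ->
  (forall v, r1 (r1 v) = r1 v) -> (forall v, r2 (r2 v) = r2 v) ->
  (forall v, r1 (r2 v) = 0) -> (forall v, r2 (r1 v) = 0) ->
  (forall v, rho (f v) = r1 (f v) + r2 (f v)) ->
  (forall v, rho (h v) = r1 (h v) + r2 (h v)) ->
  (forall v, r2 (theta v) = theta v) ->
  (forall v, h (h v) = h v) -> (forall v, piW (h v) = 0) -> (forall v, q (h v) = 0) ->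
  (forall v, r1 (h (piW v)) = 0) ->
  (forall v, h (U (piW v) + j (piW v - S (U (piW v))) + theta (piW v)) = 0) ->
  (forall v, p (f (r1 v)) + r1 (f (r1 v)) = b *: r1 v + a *: r1 (h (r1 v))) ->
  (forall v, r2 (f (j (piW v))) = a *: (theta (piW v) + r2 (h (j (piW v))))) ->
  (forall v, j (q (f (r2 v))) + r2 (f (r2 v)) = c *: r2 v + a *: r2 (h (r2 v))) ->
  combination f a b c.
Proof.
move=> b0 c0 fr BE jE pE piW_S piW_U q_ff r1_rho rho_r1 r2_rho rho_r2.
move=> r1K r2K r12 r21 rho_f' rho_h r2_theta hK piW_h q_h r1_h h_G bl1 bl_j bl2.
have p_h v : p (h v) = 0 by rewrite pE piW_h q_h linear0 addr0.
apply: (@combination_glue F V f piW q S U r1 r2 theta h B j p) => // v.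
- exact: piW_piW fr v.
- exact: q_piW fr v.
- exact: piW_q fr v.
- exact: piW_f fr v.
- exact: q_f fr v.
- by rewrite -r1_rho (rho_piW fr) linear0.
- by rewrite -r2_rho (rho_piW fr) linear0.
- by rewrite -r1_rho (rho_f fr) linear0.
- by rewrite -r2_rho (rho_f fr) linear0.
- by rewrite -rho_r1 (piW_rho fr).
- by rewrite -rho_r2 (piW_rho fr).
- by rewrite -rho_r1 (q_rho fr).
- by rewrite -rho_r2 (q_rho fr).
- by rewrite p_h q_h linear0 addr0.
- by rewrite p_h r1_h addr0.
- rewrite /= !linearB !linearZ /= p_h.
  have /eqP := bl1 v; rewrite -subr_eq => /eqP <-; mod_ring.
- by rewrite /= q_h linear0 add0r bl_j.
- rewrite /= !linearB !linearZ /= q_h.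
  have /eqP := bl2 v; rewrite -subr_eq => /eqP <-; rewrite linear0; mod_ring.
- by rewrite -addrA -rho_f' -(frame_sum fr).
by rewrite -addrA -rho_h -(frame_sum fr).
Qed.

End FrameGlue.

(** * Assembly of the finite rank case *)

Section FiniteRankCase.
Variables (F : fieldType) (V : lmodType F).
Implicit Types (f : {linear V -> V}) (U : V -> Prop).

(** On a complement of U the scalar comes from [scalar_mod_complement]; for y in U, f y - l y = (a -
    l) y + (f y - a y) lies in U as well. *)
Lemma scalar_mod_stratified f par U k m t : stratified f par U k m t ->
  (forall x, exists a, U (f x - a *: x)) ->
  exists l, forall x, U (f x - l *: x).
Proof.
move=> strat term; have [[x0 [ws [ks [ts [[cf _ _ _] [eqU _ _]]]]]]] := strat 0 0.
have eqU' v := iff_trans (eqU v) (iff_sym (lspan_vecs f ws (rcons ks x0) v)).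
have [K [_ ind spanT]] := basis_completion (indep_inl (cfree_indep (conf_free cf))).
have [x _|l lK] := scalar_mod_complement (f := f) ind spanT.
  by have [a /eqU' Ua] := term x; exists a.
have UP a y z : U y -> U z -> U (a *: y + z).
  by move=> /eqU' sy /eqU' sz; apply/eqU'; apply: spanP.
have U0 : U 0 by apply/eqU'; apply: span0.
exists l => v; move: (spanT v).
apply: (@span_elim _ _ _ _ (fun v => U (f v - l *: v))).
- by rewrite linear0 scaler0 subrr.
- move=> a y z Uy Uz; rewrite [_ - _](_ : _ = a *: (f y - l *: y) + (f z - l *: z)).
    exact: UP.
  by rewrite (linearP f); mod_ring.
case=> [i Di|x Kx] /=; last by apply/eqU'; apply: lK.
have Ui : U (with_vectors (pair_vec f) i) by apply/eqU'; apply: span_mem.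
set y := with_vectors _ _ in Ui *; have [a Ua] := term y.
rewrite [_ - _](_ : _ = (a - l) *: y + (f y - a *: y)); last by mod_ring.
exact: UP.
Qed.

(** The order of choices matters: the strata fix k, m and t, the trace condition is then solved for
    a, b, c, and only afterwards are the vectors with the resulting entries d and c chosen. *)
Lemma decomposable_finite_rank f (l : F) (zs : seq V) x :
  (forall v, spn zs (f v - l *: v)) -> (forall a b, f (f x) <> a *: x + b *: f x) ->
  decomposable f.
Proof.
move=> rk indx; have [par [U0 [k0 [m0 [t0 [strat0 k0_gt0]]]]]] := stratified_init rk indx.
have [U [k [m [t [strat k_gt0 term]]]]] := stratified_terminal rk strat0 k0_gt0.
have [mu muU] := scalar_mod_stratified strat term.
(* The coefficients of b and c in the condition that T - (a + b + c) have trace 0, for T formed with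
   f - mu. The vector x0 contributes c if [par] holds and b otherwise, besides [eps] times a. *)
pose be : F := if par then k%:R else k.+1%:R.
pose ga : F := if par then (k + m).+1%:R else (k + m)%:R.
have [|eps [a [b [c [a0 b0 c0 eq_t mu_abc]]]]] := @solve_coefficients F k%:R be ga
    (t - mu *+ (m.+1 + k.*2)) (- mu).
  by rewrite /be; case: (par) => kE; [left|right; rewrite -natr1 in kE].
(* The diagonal entry of x0 for f - mu; for f itself mu is added to it, as to the entry c of
   [ks]. *)
pose d1 := (if par then c else b) + eps%:R * a.
have [[x0 [ws [ks [ts [[cf sz_ws sz_ks sum_ts] [eqU Kc Kx]]]]]]] := strat (d1 + mu) (c + mu).
have [free sz_ts trig] := cf; have [ind uniq_ws] := free.
rewrite rcons_uniq => /andP[x0_ks uniq_ks].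
have [K [sK indK spanT]] := basis_completion ind.
have [f1 f1E] := shifted f mu.
have pb := pair_basis_shift indK spanT f1E.
have [piW [q [rho [fr piWA rhoK restrict]]]] := pair_basis_frame pb.
have Kx0 : K x0 by apply: sK; rewrite /= mem_rcons mem_head.
have Kks y : y \in ks -> K y.
  by move=> y_ks; apply: sK; rewrite /= mem_rcons inE y_ks orbT.
have {}piWA w : w \in ws -> piW w = w by move=> w_ws; apply: piWA.
have q_ws w : w \in ws -> q w = 0 by move=> /piWA<-; apply: q_piW fr _.
have q_f1 w : w \in ws -> q (f1 w) = w.
  by move=> /piWA wW; have := q_f fr w; rewrite wW.
have q_K y : K y -> q y = 0 by move=> /rhoK<-; apply: q_rho fr _.
have piW_K y : K y -> piW y = 0 by move=> /rhoK<-; apply: piW_rho fr _.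
have fE v : f v = f1 v + mu *: v by rewrite f1E subrK.
have [N NE] : exists N : {linear V -> V},
    forall v, N v = a^-1 *: (q (f1 (f1 v)) - (a + b + c) *: piW v).
  by apply: linear_pack => s y z; rewrite !linearP /=; mod_ring.
have [xc [xcA xcf xcK]] := pair_ext (E := F^o) pb (fun=> 0) (fun=> 0) (fun y => (y == x0)%:R).
(* The row of f1^2 into x0, up to the factor a; on W, the first row of U will be made equal to
   it. *)
have [xi xiE] : exists xi : {linear V -> F^o}, forall v, xi v = a^-1 *: xc (f1 (f1 v)).
  by apply: linear_pack => s y z; rewrite !linearP /= !scalerA (mulrC s).
have piW_N v : piW (N v) = N v.
  by rewrite NE linearZ linearB linearZ /= (piW_q fr) (piW_piW fr).
(* Passing from f to f - mu lowers each diagonal entry of T by 2 mu. *)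
pose n i := a^-1 * (ts`_i - mu *+ 2 - (a + b + c)).
have N_trig i : (i < size ws)%N -> spn (take i ws) (N ws`_i - n i *: ws`_i).
  move=> lti; have wi : ws`_i \in ws by rewrite mem_nth.
  have := trig i lti; set r := _ - _ => rP.
  have -> : N ws`_i - n i *: ws`_i = a^-1 *: q r.
    have -> : r = f1 (f1 ws`_i) + (mu *+ 2 - ts`_i) *: f1 ws`_i +
        (mu * mu - ts`_i * mu) *: ws`_i.
      by rewrite /r (fE (f _)) fE (linearD f1) linearZ /=; mod_ring.
    rewrite NE piWA // !(linearD q) !linearZ /= (q_f1 ws`_i) // (q_ws ws`_i) // /n.
    by mod_ring.
  apply: spnZ; apply: (@span_elim _ _ _ id (fun r => spn (take i ws) (q r))) rP.
  - by rewrite linear0; apply: spn0.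
  - by move=> s y z sy sz; rewrite linearP; apply: spanP.
  move=> y /=; rewrite !mem_cat => /or3P[y_ws|y_ks|/mapP[w w_ws ->]].
  - by rewrite q_ws //; apply: spn0.
  - by rewrite q_K; [apply: spn0|apply: sK].
  have w_ws' := mem_take w_ws.
  by rewrite fE linearD linearZ /= q_f1 // q_ws // scaler0 addr0; apply: spn_mem.
have trace_N : \sum_(i < size ws) n i = 0.
  rewrite -mulr_sumr; set s := \sum_(i < _) _.
  suff -> : s = 0 by rewrite mulr0.
  rewrite /s !sumrB !sumr_const card_ord -(big_mkord xpredT (nth 0 ts)) -sz_ts.
  rewrite -(big_nth 0 xpredT id) sum_ts sz_ts sz_ws.
  have tE : t = (k%:R + eps%:R) * a + be * b + ga * c + mu *+ (m.+1 + k * 2).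
    by rewrite muln2 eq_t subrK.
  by rewrite tE /d1 /be /ga; case: (par); ring.
have [S [C [psi [piW_S piW_C comm psiC]]]] :=
  triangular_commutator xi uniq_ws pb piWA piW_N N_trig trace_N.
have [B BE] : exists B : {linear V -> V}, forall v, B v = a *: C (S v) + b *: v.
  by apply: linear_pack => s y z; rewrite !linearP /=; mod_ring.
have [j jE] : exists j : {linear V -> V}, forall v, j v = f1 v - B v.
  by apply: linear_pack => s y z; rewrite !linearP /=; mod_ring.
have [p pE] : exists p : {linear V -> V}, forall v, p v = piW v + B (q v).
  by apply: linear_pack => s y z; rewrite !linearP /=; mod_ring.
(* [rk0] and, below, [rx] are the projections onto the spans of [ks] and of x0 along the other basis
   vectors. *)
have [rk0 [rkA rkf rkK]] := pair_ext pb (fun=> 0) (fun=> 0)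
  (fun y => if y \in ks then y else 0).
have scal (s : F) : exists g : {linear V -> V}, forall v, g v = s *: v.
  by apply: linear_pack => s' y z; rewrite scalerDr !scalerA mulrC.
have [rx rxE] : exists rx : {linear V -> V}, forall v, rx v = xc v *: x0.
  apply: linear_pack => s y z; rewrite linearP /= scalerDl scalerA.
  by congr (_ *: _ + _).
have xc_x0 : xc x0 = 1 by rewrite xcK // eqxx.
have xc_ks y : y \in ks -> xc y = 0.
  move=> y_ks; rewrite (xcK _ (Kks _ y_ks)) //; have /negPf-> // : y != x0.
  by apply: contraNneq x0_ks => <-.
have rk_x0 : rk0 x0 = 0 by rewrite rkK // (negPf x0_ks).
have rk_ks y : y \in ks -> rk0 y = y by move=> y_ks; rewrite (rkK _ (Kks _ y_ks)) // y_ks.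
have rho_ws w : w \in ws -> rho w = 0 by move=> /piWA<-; apply: rho_piW fr _.
have rho_f1 w : w \in ws -> rho (f1 w) = 0.
  by move=> /piWA wW; have := rho_f fr w; rewrite wW.
have restrictK (E : lmodType F) (g h : {linear V -> E}) :
    (forall y, y \in ks -> g y = h y) -> forall v, g (rk0 v) = h (rk0 v).
  move=> eq_ks; apply: (pair_eq pb (g := g \o rk0) (h := h \o rk0)) => y Ay /=.
  - by rewrite rkA // !linear0.
  - by rewrite rkf // !linear0.
  by rewrite rkK //; case: ifP => [/eq_ks//|_]; rewrite !linear0.
have ks_rho (E : lmodType F) (g : {linear V -> E}) :
    (forall w, w \in ws -> g w = 0) -> (forall w, w \in ws -> g (f1 w) = 0) ->
    forall v, g (rho v) = g v.
  move=> gA gf; apply: (pair_eq pb (g := g \o rho) (h := g)) => y Ay /=.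
  - by rewrite rho_ws // (gA y) // linear0.
  - by rewrite rho_f1 // (gf y) // linear0.
  by rewrite rhoK.
have rk_rho := ks_rho _ rk0 rkA rkf; have xc_rho := ks_rho _ xc xcA xcf.
have rho_rk v : rho (rk0 v) = rk0 v.
  by apply: (restrictK _ rho idfun) => y y_ks; rewrite /= (rhoK _ (Kks _ y_ks)).
have rk_rk v : rk0 (rk0 v) = rk0 v by apply: (restrictK _ rk0 idfun) => y /rk_ks.
have xc_rk v : xc (rk0 v) = 0 by apply: (restrictK _ xc \0) => y /xc_ks.
have spn_ws u : spn ws u -> [/\ q u = 0, rk0 u = 0 & xc u = 0].
  by move=> su; split; apply: linear_span0 su => y /=; auto.
have spn_ks u : spn ks u -> [/\ q u = 0, piW u = 0 & xc u = 0].
  by move=> su; split; apply: linear_span0 su => y /= y_ks; auto.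
have f1_ks y : y \in ks -> exists2 u, spn ws u & f1 y = c *: y + u.
  move=> y_ks; exists (f y - (c + mu) *: y); first exact: Kc.
  by rewrite f1E; mod_ring.
have f1_x0 : exists2 u, spn (if par then ws else ks) u & f1 x0 = d1 *: x0 + u.
  exists (f x0 - (d1 + mu) *: x0) => //.
  by rewrite f1E; mod_ring.
have q_f1_rk v : q (f1 (rk0 v)) = 0.
  apply: (restrictK _ (q \o f1) \0) => y y_ks /=; have [u /spn_ws[qu _ _] ->] := f1_ks y y_ks.
  by rewrite linearD linearZ /= qu (q_K _ (Kks _ y_ks)) // scaler0 addr0.
have xc_f1_rk v : xc (f1 (rk0 v)) = 0.
  apply: (restrictK _ (xc \o f1) \0) => y y_ks /=; have [u /spn_ws[_ _ xu] ->] := f1_ks y y_ks.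
  by rewrite linearD linearZ /= xu xc_ks // scaler0 addr0.
have rk_f1_rk v : rk0 (f1 (rk0 v)) = c *: rk0 v.
  have [g gE] := scal c; rewrite -gE.
  apply: (restrictK _ (rk0 \o f1) g) => y y_ks /=; have [u /spn_ws[_ ru _] ->] := f1_ks y y_ks.
  by rewrite linearD linearZ /= ru rk_ks // addr0 gE.
(* f1 maps V into U, so vectors of [K] other than x0 and [ks] do not occur in its values. *)
have rho_f1_split v : rho (f1 v) = rk0 (f1 v) + rx (f1 v).
  have [g gE] : exists g : {linear V -> V}, forall v, g v = rho v - (rk0 v + rx v).
    by apply: linear_pack => s y z; rewrite !linearP /=; mod_ring.
  apply/eqP; rewrite -subr_eq0 -gE; apply/eqP.
  have /eqU : U (f1 v) by rewrite f1E; apply: muU.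
  apply: linear_span0 => y /=; rewrite gE rxE !mem_cat mem_rcons inE.
  case/or3P=> [y_ws|/mapP[w w_ws ->]|/predU1P[->|y_ks]].
  - by rewrite rho_ws // rkA // xcA // scale0r addr0 subrr.
  - rewrite fE !linearD !linearZ /= (rho_ws w) // (rho_f1 w) // (rkA w) // (rkf w) //.
    rewrite (xcA w) // (xcf w) //.
    by rewrite !(scaler0, addr0, oppr0, scale0r).
  - by rewrite rhoK // rk_x0 xc_x0 scale1r add0r subrr.
  by rewrite (rhoK _ (Kks _ y_ks)) // rk_ks // xc_ks // scale0r addr0 subrr.
have q_ff v : q (f1 (f1 (piW v))) =
    (a + b + c) *: piW v + a *: (C (S (piW v)) - S (C (piW v))).
  have [g gE] : exists g : {linear V -> V},
      forall v, g v = (a + b + c) *: v + a *: (C (S v) - S (C v)).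
    by apply: linear_pack => s y z; rewrite !(linearP, linearB) /=; mod_ring.
  rewrite -gE; apply: (restrict _ (q \o f1 \o f1) g) => w w_ws /=.
  rewrite gE comm // NE piWA // scalerA divff // scale1r.
  by rewrite addrC subrK.
suff comb : combination f1 a b c.
  apply: combination_shift f1E comb _; case: mu_abc => [/eqP|]; last by right.
  by rewrite oppr_eq0 => /eqP; left.
have W_xc v : piW v = v -> xc v = 0.
  by move=> <-; rewrite -xc_rho (rho_piW fr) linear0.
have W_rk v : piW v = v -> rk0 v = 0.
  by move=> <-; rewrite -rk_rho (rho_piW fr) linear0.
have W_q v : piW v = v -> q v = 0 by move=> <-; apply: q_piW fr _.
have W_B v : piW v = v -> piW (B v) = B v.
  by move=> vW; rewrite BE linearD !linearZ /= piW_C vW.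
have W_p v : piW v = v -> p v = v by move=> vW; rewrite pE W_q // linear0 addr0.
have W_j v : piW v = v -> [/\ q (j v) = v, rk0 (j v) = 0, xc (j v) = 0 & p (j v) = 0].
  move=> vW; have f1v : [/\ piW (f1 v) = 0, q (f1 v) = v & rho (f1 v) = 0].
    by rewrite -vW (piW_f fr) (q_f fr) (rho_f fr).
  have [f1v1 f1v2 f1v3] := f1v.
  have qj : q (j v) = v by rewrite jE linearB /= f1v2 (W_q (B v)) ?W_B // subr0.
  split=> //.
  - by rewrite -rk_rho jE !linearB /= f1v3 rk_rho (W_rk (B v)) ?W_B // linear0 subr0.
  - by rewrite -xc_rho jE !linearB /= f1v3 xc_rho (W_xc (B v)) ?W_B // linear0 subr0.
  by rewrite pE qj jE linearB /= f1v1 W_B // sub0r addNr.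
have piW_rk v : piW (rk0 v) = 0 by rewrite -rho_rk (piW_rho fr).
have q_rk v : q (rk0 v) = 0 by rewrite -rho_rk (q_rho fr).
have rx_rho v : rx (rho v) = rx v by rewrite !rxE xc_rho.
have rho_rx v : rho (rx v) = rx v by rewrite rxE linearZ /= rhoK.
have rx_rk v : rx (rk0 v) = 0 by rewrite rxE xc_rk scale0r.
have rk_rx v : rk0 (rx v) = 0 by rewrite rxE linearZ /= rk_x0 scaler0.
have rx_rx v : rx (rx v) = rx v by rewrite !rxE linearZ /= xc_x0 [_ *: 1]mulr1.
have piW_rx v : piW (rx v) = 0 by rewrite -rho_rx (piW_rho fr).
have q_rx v : q (rx v) = 0 by rewrite -rho_rx (q_rho fr).
have W_rx v : piW v = v -> rx v = 0 by move=> vW; rewrite rxE W_xc // scale0r.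
have WSC v : piW (piW v - S (C (piW v))) = piW v - S (C (piW v)).
  by rewrite linearB /= (piW_piW fr) piW_S.
have rx_j v : piW v = v -> rx (j v) = 0.
  by move=> vW; have [_ _ xj _] := W_j v vW; rewrite rxE xj scale0r.
(* Determined by the second block: a theta has to cancel the row of f1 from j(W) into the span of
   [ks]. *)
have [theta thE] : exists theta : {linear V -> V},
    forall v, theta v = a^-1 *: rk0 (f1 (j v)).
  by apply: linear_pack => s y z; rewrite !linearP /=; mod_ring.
(* If par fails, x0 belongs to the first block and its diagonal entry is b or a + b.
   Otherwise it belongs to the second block: the entry c is compatible with the rows
   of e1 through theta, whereas for the entry c + a a row [om] into x0 has to vanish
   on the image of e1, which is what the choice of psi ensures. *)
case: (par) @be @ga @d1 eq_t Kx f1_x0 sum_ts => be ga d1 _ _ [u su f1x0] _; last first.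
- have [qu pu xu] := spn_ks u su.
  (* Subtracting a h from the entry d1 = b + eps a of x0 leaves b. *)
  have [h hE] : exists h : {linear V -> V}, forall v, h v = eps%:R *: rx v.
    by apply: linear_pack => s y z; rewrite !linearP /=; mod_ring.
  apply: (@combination_frame F V f1 piW q rho S C rx rk0 theta h B j p a b c) => // v.
  + by rewrite addrC rho_f1_split.
  + by rewrite hE !linearZ /= rho_rx rx_rx rk_rx scaler0 addr0.
  + by rewrite thE linearZ /= rk_rk.
  + by rewrite !hE linearZ /= rx_rx scalerA -natrM mulnb andbb.
  + by rewrite hE linearZ /= piW_rx scaler0.
  + by rewrite hE linearZ /= q_rx scaler0.
  + by rewrite hE linearZ /= rx_rx W_rx ?(piW_piW fr) // scaler0.
  + rewrite hE !(linearD rx) /= (rx_j _ (WSC v)) (W_rx _ (piW_C _)) thE linearZ /= rx_rk.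
    by rewrite !(scaler0, addr0).
  + have f1rx : f1 (rx v) = xc v *: (d1 *: x0 + u) by rewrite rxE linearZ /= f1x0.
    rewrite hE !linearZ /= !rx_rx f1rx pE !linearZ /= !linearD !linearZ /= qu pu.
    rewrite (piW_K _ Kx0) (q_K _ Kx0) (linear0 B) !rxE xc_x0 xu /d1 /=; mod_ring.
  + by rewrite hE rx_j ?(piW_piW fr) // scaler0 linear0 addr0 thE scalerA divff // scale1r.
  by rewrite q_f1_rk rk_f1_rk hE linearZ /= rk_rx; rewrite linear0 !scaler0 add0r addr0.
have [qu ru xu] := spn_ws u su.
have [r2 r2E] : exists r2 : {linear V -> V}, forall v, r2 v = rk0 v + rx v.
  by apply: linear_pack => s y z; rewrite !linearP /=; mod_ring.
have f1rx v : f1 (rx v) = xc v *: (d1 *: x0 + u) by rewrite rxE linearZ /= f1x0.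
have q_f1_rx v : q (f1 (rx v)) = 0.
  by rewrite f1rx !(linearZ, linearD) /= qu (q_K _ Kx0) scaler0 addr0 scaler0.
have r2_f1_rx v : r2 (f1 (rx v)) = d1 *: rx v.
  have rk_u : rk0 (d1 *: x0 + u) = 0 by rewrite linearD linearZ /= rk_x0 ru scaler0 addr0.
  have xc_u : xc (d1 *: x0 + u) = d1.
    by rewrite linearD linearZ /= xc_x0 xu addr0 [_ *: 1]mulr1.
  rewrite r2E f1rx !rxE !linearZ /= rk_u xc_u scaler0 add0r scalerA.
  by congr (_ *: _); apply: mulrC.
have r2_f1_rk v : r2 (f1 (rk0 v)) = c *: rk0 v.
  by rewrite r2E rk_f1_rk rxE xc_f1_rk scale0r addr0.
have q_f1_r2 v : q (f1 (r2 v)) = 0 by rewrite r2E !linearD /= q_f1_rk q_f1_rx addr0.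
have W_r2 v : piW v = v -> r2 v = 0 by move=> vW; rewrite r2E W_rk // W_rx // addr0.
have r2_j v : piW v = v -> r2 (j v) = 0.
  by move=> vW; have [_ rj _ _] := W_j v vW; rewrite r2E rj rx_j // addr0.
have r2_r2 v : r2 (r2 v) = r2 v.
  by rewrite !r2E !linearD /= rk_rk rk_rx rx_rx rx_rk addr0 add0r.
case: eps @d1 f1x0 f1rx r2_f1_rx => d1 f1x0 f1rx r2_f1_rx; last first.
- have [th2 th2E] : exists th2 : {linear V -> V},
      forall v, th2 v = a^-1 *: r2 (f1 (j v)).
    by apply: linear_pack => s y z; rewrite !linearP /=; mod_ring.
  apply: (@combination_frame F V f1 piW q rho S C \0 r2 th2 \0 B j p a b c) => //= v;
    rewrite ?linear0 //.
  + by rewrite !r2E rk_rho rx_rho.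
  + by rewrite r2E linearD /= rho_rk rho_rx.
  + by rewrite add0r r2E rho_f1_split.
  + by rewrite addr0.
  + by rewrite th2E linearZ /= r2_r2.
  + by rewrite addr0 th2E scalerA divff // scale1r.
  rewrite q_f1_r2 linear0 addr0 add0r (r2E v) !(linearD f1) !(linearD r2) /=.
  by rewrite r2_f1_rk r2_f1_rx /d1 mulr0n mul0r !addr0 -scalerDr.
have [eta etaE] : exists eta : {linear V -> F^o},
    forall v, eta v = xi (S v) - psi v.
  by apply: linear_pack => s y z; rewrite !linearP /= /GRing.scale /=; ring.
(* [om] is 1 at x0, [eta] on W and [xi] on j(W), the last being forced by the row of f1 into x0. On
   the image of w under G it gives xi (S U w) - psi (U w) + xi (w - S U w) = xi w - psi (U w) = 0,
   with U named [C] here. *)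
have [om omE] : exists om : {linear V -> F^o},
    forall v, om v = xc v + eta (p v) + xi (q v).
  apply: linear_pack => s y z; rewrite !linearP /= /GRing.scale /=; ring.
have [h hE] : exists h : {linear V -> V}, forall v, h v = om v *: x0.
  apply: linear_pack => s y z; rewrite linearP /= scalerDl scalerA.
  by congr (_ *: _ + _).
have p_x0 : p x0 = 0 by rewrite pE (piW_K _ Kx0) (q_K _ Kx0) (linear0 B) addr0.
have om_x0 : om x0 = 1 by rewrite omE xc_x0 p_x0 (q_K _ Kx0) !linear0 !addr0.
have r2_x0 : r2 x0 = x0 by rewrite r2E rk_x0 rxE xc_x0 scale1r add0r.
have r2_h v : r2 (h v) = h v by rewrite hE linearZ /= r2_x0.
have psi_C v : psi (C (piW v)) = xi (piW v).
  by apply: (restrict _ (psi \o C) xi) => w w_ws; apply: psiC.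
have om_rk v : om (rk0 v) = 0.
  by rewrite omE pE piW_rk q_rk xc_rk (linear0 B) addr0 !linear0 !addr0.
have om_rx v : om (rx v) = xc v.
  by rewrite rxE linearZ /= om_x0 [_ *: 1]mulr1.
have rho_h v : rho (h v) = h v by rewrite hE linearZ /= rhoK.
apply: (@combination_frame F V f1 piW q rho S C \0 r2 theta h B j p a b c) => //= v;
  rewrite ?linear0 //.
- by rewrite !r2E rk_rho rx_rho.
- by rewrite r2E linearD /= rho_rk rho_rx.
- by rewrite add0r r2E rho_f1_split.
- by rewrite add0r r2_h.
- by rewrite thE linearZ /= r2E rk_rk rx_rk addr0.
- by rewrite !hE linearZ /= om_x0 [_ *: 1]mulr1.
- by rewrite -rho_h (piW_rho fr).
- by rewrite -rho_h (q_rho fr).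
- have [qj _ xj pj] := W_j _ (WSC v).
  have th0 : om (theta (piW v)) = 0 by rewrite thE linearZ /= om_rk scaler0.
  rewrite hE !(linearD om) /= th0 !omE xj pj qj (W_q _ (piW_C _)) (W_xc _ (piW_C _)).
  rewrite (W_p _ (piW_C _)) etaE psi_C linearB !linear0 /=.
  by mod_ring.
- have [qj _ xj pj] := W_j _ (piW_piW fr v).
  have xc_f1 y : piW y = y -> xc (f1 y) = 0.
    by move=> <-; rewrite -xc_rho (rho_f fr) linear0.
  have xc_f1j : xc (f1 (j (piW v))) = xc (f1 (f1 (piW v))).
    rewrite [j _]jE !linearB /= (xc_f1 (B _)) ?subr0 //.
    by apply: W_B; apply: piW_piW fr v.
  rewrite r2_h hE omE xj pj qj linear0 !add0r xiE r2E rxE xc_f1j thE scalerDr !scalerA.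
  by rewrite [_ *: xc _]/(_ * xc _) mulrA divff // scale1r mul1r.
rewrite q_f1_r2 linear0 add0r r2_h hE (r2E v) !(linearD f1) !(linearD r2) !(linearD om) /=.
by rewrite r2_f1_rk r2_f1_rx om_rk om_rx add0r -rxE /d1 mulr1n mul1r; mod_ring.
Qed.

End FiniteRankCase.

Unset Implicit Arguments.

Theorem theorem7 (F : fieldType) (V : lmodType F) (f : {linear V -> V}) :
  exists (a b c : F) (e1 e2 e3 : {linear V -> V}),
    [/\ idempotent_endo e1, idempotent_endo e2, idempotent_endo e3 &
        forall v : V, f v = a *: e1 v + b *: e2 v + c *: e3 v].
Proof.
change (decomposable f).
have [A [indA eigA]] := maximal_pairs f.
have [finA|infA] := pselect (finite_set A); last exact: decomposable_infinite infA.
have [l [zs rk]] := finite_pairs_rank indA eigA finA.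
have [[x indx]|quad] := pselect (exists x, forall a b, f (f x) <> a *: x + b *: f x).
  exact: decomposable_finite_rank rk indx.
apply: decomposable_quadratic indA eigA _ => x; apply: contrapT => nquad.
by apply: quad; exists x => a b fE; apply: nquad; exists a, b.
Qed.
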